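(* Let $P,Q$ be distributions on $\mathcal{X}\times\{0,1\}$ and let $(X_1,Y_1),\dots,(X_m,Y_m)\stackrel{iid}{\sim}P$ and $X_{m+1},\dots,X_{m+n}\stackrel{iid}{\sim}Q_X$ be independent samples. Assume (A), (B), (C') below hold. Let $k$ be a universal kernel with RKHS $\mathcal{H}$, and let $\lambda=\lambda_m$ satisfy $\lambda\to0$ and $m\lambda^2\to\infty$. Let $\widehat f_P$ solve $$\min_{f\in\mathcal{H}}\ \frac{\lambda}{2}\|f\|_{\mathcal{H}}^2+\frac1m\sum_{i=1}^m\log\big(1+\exp(-(2Y_i-1)f(X_i))\big),$$ $\widehat\eta_P(x)=1/(1+\exp(-\widehat f_P(x)))$, $\widehat Q_X(G)=\frac1n\sum_{i=m+1}^{m+n}\mathbf{1}\{X_i\in G\}$, $\epsilon_n=4(\log(n+1)/n)^{1/2}$, and for tuning parameters $\beta,\gamma$, $$\widehat t_{P,Q,\alpha}=\inf\{t:\widehat Q_X(\{x:\widehat\eta_P(x)\ge t+\beta\})\le\alpha+\gamma+\epsilon_n\},\qquad \widehat G_{P,Q,\alpha}=\{x:\widehat\eta_P(x)\ge\widehat t_{P,Q,\alpha}\}.$$ Then for every $\epsilon>0$ there exist $\beta$ and $\gamma$ such that $\Pr\big(Q_X(\widehat G_{P,Q,\alpha}\Delta G_{P,Q,\alpha})\le\epsilon\big)\to1$ as $m,n\to\infty$. Assumptions: (A) there exists $t_{P,Q,\alpha}\in(0,1]$ with $Q_X(\{x:\eta_P(x)\ge t_{P,Q,\alpha}\})=\alpha$;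 (B) there are positive constants $\delta_0,b_1,b_2,\kappa$ such that for all $\delta\in[-\delta_0,\delta_0]$, $b_1|\delta|^\kappa\le|F_{P,Q}(t_{P,Q,\alpha}+\delta)-F_{P,Q}(t_{P,Q,\alpha})|\le b_2|\delta|^\kappa$; (C') there exists $c_0>0$ with $Q_X\le c_0P_X$.
   Context: $\mathcal{X}$ is a compact subset of $\mathbb{R}^d$. For a distribution $P$ of $(X,Y)\in\mathcal{X}\times\{0,1\}$, $P_X$ is the marginal of $X$ and $\eta_P(x)=P(Y=1\mid X=x)$; similarly $Q_X$ for $Q$. $\alpha\in(0,1)$ is fixed. $F_{P,Q}(t)=Q_X(\{x:\eta_P(x)\le t\})$; $G_{P,Q,\alpha}=\{x:\eta_P(x)\ge t_{P,Q,\alpha}\}$ with $t_{P,Q,\alpha}$ the (unique, under (A),(B)) threshold from (A). A universal kernel is a continuous symmetric positive definite kernel whose RKHS is dense in the continuous functions on $\mathcal{X}$ in sup norm. $\Pr$ is the product measure governing both samples; $\Delta$ is symmetric difference. *)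

(* Defs.v *)
From HB Require Import structures.
From mathcomp Require Import all_boot all_order all_algebra.
From mathcomp Require Import all_classical all_reals all_analysis.
Set Implicit Arguments. Unset Strict Implicit. Unset Printing Implicit Defensive.
Import Order.TTheory GRing.Theory Num.Theory.
Import numFieldNormedType.Exports.
Local Open Scope classical_set_scope.
Local Open Scope ring_scope.

Definition Rd (R : realType) (d : nat) := g_sigma_algebraType (@open 'rV[R]_d).

Section defs.
Variables (R : realType) (d : nat).
Local Notation V := 'rV[R]_d.

Definition ksec (X : set V) (k : V -> V -> R) (x : V) : V -> R :=
  fun y => if `[< X y >] then k x y else 0.

Definition pd_kernel (X : set V) (k : V -> V -> R) : Prop :=
  [/\ {within X `*` X, continuous (fun p : V * V => k p.1 p.2)},
      (forall x y, X x -> X y -> k x y = k y x) &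
      (forall (n : nat) (xs : 'I_n -> V) (c : 'I_n -> R),
          (forall i, X (xs i)) ->
          0 <= \sum_(i < n) \sum_(j < n) c i * c j * k (xs i) (xs j))].

(* H (a set of real functions on X, represented as functions on R^d vanishing
   off X) with inner product ip is the reproducing kernel Hilbert space of k. *)
Definition is_RKHS (X : set V) (k : V -> V -> R) (H : set (V -> R))
    (ip : (V -> R) -> (V -> R) -> R) : Prop :=
  H (fun _ => 0) /\
      (forall f g, H f -> H g -> H (fun x => f x + g x)) /\
      (forall (a : R) f, H f -> H (fun x => a * f x)) /\
      (forall f, H f -> forall x, ~ X x -> f x = 0) /\
      (forall f g h, H f -> H g -> H h -> ip (fun x => f x + g x) h = ip f h + ip g h) /\
      (forall (a : R) f g, H f -> H g -> ip (fun x => a * f x) g = a * ip f g) /\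
      (forall f g, H f -> H g -> ip f g = ip g f) /\
      (forall f, H f -> 0 <= ip f f) /\
      (forall f, H f -> ip f f = 0 -> f = fun _ => 0) /\
      (forall u : nat -> V -> R, (forall p, H (u p)) ->
         (forall e : R, 0 < e -> exists N : nat, forall p q, (N <= p)%N -> (N <= q)%N ->
             ip (fun x => u p x - u q x) (fun x => u p x - u q x) <= e) ->
         exists f, H f /\
           (fun p => ip (fun x => u p x - f x) (fun x => u p x - f x)) @ \oo --> 0) /\
      (forall x, X x -> H (ksec X k x) /\ forall f, H f -> f x = ip f (ksec X k x)).

Definition universal_kernel (X : set V) (k : V -> V -> R) (H : set (V -> R))
    (ip : (V -> R) -> (V -> R) -> R) : Prop :=
  [/\ pd_kernel X k, is_RKHS X k H ip &
      forall g : V -> R, {within X, continuous g} ->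
        forall e : R, 0 < e -> exists f, H f /\ forall x, X x -> `|f x - g x| <= e].

Definition klr_obj (ip : (V -> R) -> (V -> R) -> R) (lam : R) (m : nat)
    (D : nat -> Rd R d * bool) (f : V -> R) : R :=
  lam / 2 * ip f f +
  m%:R^-1 * \sum_(i < m)
     ln (1 + expR (- ((if (D i).2 then 1 else -1) * f (D i).1))).

Definition klr_solution (H : set (V -> R)) (ip : (V -> R) -> (V -> R) -> R)
    (lam : R) (m : nat) (D : nat -> Rd R d * bool) (f : V -> R) : Prop :=
  H f /\ forall g, H g -> klr_obj ip lam m D f <= klr_obj ip lam m D g.

Definition etahat (f : V -> R) (x : V) : R := 1 / (1 + expR (- f x)).

Definition emp_QX (n : nat) (Wn : nat -> Rd R d) (G : set V) : R :=
  (\sum_(j < n) (if `[< G (Wn j) >] then 1 else 0)) / n%:R.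

Definition eps_n (n : nat) : R := 4 * Num.sqrt (ln (n.+1)%:R / n%:R).

Definition that (f : V -> R) (n : nat) (Wn : nat -> Rd R d)
    (alpha beta gamma : R) : \bar R :=
  ereal_inf [set t%:E | t in
     [set t : R | emp_QX n Wn [set x | t + beta <= etahat f x]
                  <= alpha + gamma + eps_n n]].

Definition Ghat (f : V -> R) (n : nat) (Wn : nat -> Rd R d)
    (alpha beta gamma : R) : set V :=
  [set x | (that f n Wn alpha beta gamma <= (etahat f x)%:E)%E].

End defs.

Definition two_iid_samples (R : realType) (d : nat) (dO : measure_display)
    (Omega : measurableType dO) (Pr : probability Omega R)
    (Z : nat -> Omega -> (Rd R d * bool)%type) (W : nat -> Omega -> Rd R d)
    (P : set (Rd R d * bool)%type -> \bar R) (QX : set (Rd R d) -> \bar R) : Prop :=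
  [/\ (forall i, measurable_fun setT (Z i)),
      (forall j, measurable_fun setT (W j)) &
      forall (m n : nat) (A : nat -> set (Rd R d * bool)%type) (B : nat -> set (Rd R d)),
        (forall i, measurable (A i)) -> (forall j, measurable (B j)) ->
        Pr ([set w | forall i, (i < m)%N -> A i (Z i w)] `&`
            [set w | forall j, (j < n)%N -> B j (W j w)]) =
        (\prod_(i < m) P (A i) * \prod_(j < n) QX (B j))%E].

(* Main.v *)
(* Regularized kernel logistic regression is stable: since the empirical
   objective is [lam]-strongly convex, its minimizer is within [2 z / lam] (in
   the RKHS norm) of any [g] at which the empirical gradient has norm at most [z].
   Take for [g] an almost-minimizer of the population objective. Its population
   gradient almost vanishes, and the empirical gradient concentrates around it at
   the dimension-free rate [m^(-1/2)], so [m lam^2 -> oo] makes [fhat] uniformly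
   close to the deterministic function [g], with high probability. By
   universality and [lam -> 0] the excess logistic risk of [g] vanishes; that
   excess is a Kullback-Leibler divergence, which controls the squared distance
   of [sigmoid g] to [eta] in L^2(P_X), hence by (C') in Q_X-probability. All
   random sets entering the threshold are thereby sandwiched between three
   deterministic ones, for which Chebyshev's inequality suffices, and the margin
   condition (B) locates the threshold. *)
Require Import Defs.
From HB Require Import structures.
From mathcomp Require Import all_boot all_order all_algebra.
From mathcomp Require Import all_classical all_reals all_analysis.
From mathcomp Require Import measurable_realfun ring lra.
Set Implicit Arguments. Unset Strict Implicit. Unset Printing Implicit Defensive.
Import Order.TTheory GRing.Theory Num.Theory.
Import numFieldNormedType.Exports.
Local Open Scope classical_set_scope.
Local Open Scope ring_scope.

(** * Scalar inequalities for the logistic loss *)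

(** The minimizer [fhat] is not known to depend measurably on the sample, so probabilities are
    estimated only for events built from deterministic functions and sets. Off these events the
    bounds hold for whichever minimizer is given; this is why the conclusion exhibits a measurable
    event inside the good set. The gradient deviation lives in the RKHS, yet no vector-valued
    integral is formed. Compactness splits [X] into finitely many Borel cells of small kernel
    diameter, on which the gradient is nearly constant; the squared norm of the resulting finite
    kernel combination is a quadratic form in cell frequencies, with mean at most K^2/m whatever the
    number of cells. The function [g] varies with [m], through [lam m], but not with the data. The
    tuning parameters are [beta = 0] and a quarter of b1 (2 delta)^kappa for [gamma]. The true set
    has mass exactly [alpha], so a positive [gamma] must absorb its sampling error; the margin
    condition places mass 4 gamma just below the threshold, which keeps lower levels infeasible in
    spite of [gamma] and [eps_n]. *)

Definition sigmoid (R : realType) (a : R) : R := 1 / (1 + expR (- a)).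

Definition logistic_loss (R : realType) (y : bool) (a : R) : R :=
  ln (1 + expR (- ((if y then 1 else -1) * a))).

(* The derivative of [logistic_loss y]. *)
Definition logistic_grad (R : realType) (y : bool) (a : R) : R :=
  sigmoid a - (if y then 1 else 0).

(** The infimum over [a] of the logistic risk of a label that is true with probability [p]. At the
    endpoints the factor [p] or [1 - p] removes the default value of [ln 0]. *)
Definition binary_entropy (R : realType) (p : R) : R :=
  - (p * ln p) - (1 - p) * ln (1 - p).

Section scalar.
Context {R : realType}.
Implicit Types (a b p s : R) (y : bool).

Lemma sigmoid_gt0 a : 0 < sigmoid a.
Proof. by rewrite /sigmoid divr_gt0// addr_gt0// expR_gt0. Qed.

Lemma sigmoid_lt1 a : sigmoid a < 1.
Proof.
rewrite /sigmoid ltr_pdivrMr ?mul1r ?addr_gt0 ?expR_gt0//.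
by rewrite ltrDl expR_gt0.
Qed.

Lemma sigmoidN a : sigmoid (- a) = 1 - sigmoid a.
Proof.
rewrite /sigmoid opprK.
have e0 : 0 < expR (- a) := expR_gt0 _.
have -> : expR a = (expR (- a))^-1 by rewrite expRN invrK.
by field; rewrite !gt_eqF//; lra.
Qed.

Lemma ln_sigmoid a : ln (1 + expR (- a)) = - ln (sigmoid a).
Proof. by rewrite /sigmoid mul1r lnV ?opprK// posrE addr_gt0// expR_gt0. Qed.

Lemma logistic_lossE y a :
  logistic_loss y a = - ln (if y then sigmoid a else 1 - sigmoid a).
Proof.
rewrite /logistic_loss; case: y; first by rewrite mul1r ln_sigmoid.
by rewrite mulN1r ln_sigmoid sigmoidN.
Qed.

Lemma logistic_loss_ge0 y a : 0 <= logistic_loss y a.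
Proof. by rewrite /logistic_loss ln_ge0// lerDl expR_ge0. Qed.

Lemma logistic_grad_le1 y a : `|logistic_grad y a| <= 1.
Proof.
have := sigmoid_gt0 a; have := sigmoid_lt1 a.
rewrite /logistic_grad ler_norml; case: y => ? ?; lra.
Qed.

(** Convexity of the exponential without derivatives: the tangent at [s * b], evaluated at [b] and
    at 0, is averaged with weights [s] and [1 - s]. *)
Lemma expR_weighted s b : 0 <= s -> s <= 1 ->
  expR (s * b) <= 1 + s * (expR b - 1).
Proof.
move=> s0 s1; have e0 := expR_gt0 (s * b).
have h1 : expR (s * b) * (1 + (b - s * b)) <= expR b.
  have -> : expR b = expR (s * b) * expR (b - s * b).
    by rewrite -expRD; congr expR; ring.
  by rewrite ler_pM2l// expR_ge1Dx.
have h2 : expR (s * b) * (1 - s * b) <= 1.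
  have -> : (1 : R) = expR (s * b) * expR (- (s * b)).
    by rewrite -expRD subrr expR0.
  rewrite -[X in X * (_ - _) <= _]mulr1 -mulrA ler_pM2l// mul1r.
  rewrite -expRD subrr expR0; exact: expR_ge1Dx.
by have := ler_wpM2l s0 h1; have := @ler_wpM2l _ (1 - s) ltac:(lra) _ _ h2; nra.
Qed.

(** An increment of softplus is exactly the log-moment generating function at [b] of a Bernoulli
    variable of parameter [sigmoid a]. The tangent and the quadratic bound are both read off this
    identity. *)
Lemma softplusD a b :
  ln (1 + expR (a + b)) = ln (1 + expR a) + ln (1 + sigmoid a * (expR b - 1)).
Proof.
have ea := expR_gt0 a; have eb := expR_gt0 b.
have s0 := sigmoid_gt0 a; have s1 := sigmoid_lt1 a.
rewrite -lnM ?posrE; first last.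
- nra.
- by rewrite addr_gt0.
congr ln; rewrite expRD /sigmoid.
have -> : expR (- a) = (expR a)^-1 by rewrite expRN.
field; rewrite (gt_eqF ea)/= gt_eqF//; lra.
Qed.

Lemma softplus_tangent a b :
  ln (1 + expR a) + sigmoid a * b <= ln (1 + expR (a + b)).
Proof.
rewrite softplusD lerD2l.
have s0 := ltW (sigmoid_gt0 a); have s1 := ltW (sigmoid_lt1 a).
rewrite -{1}(expRK (sigmoid a * b)) ler_ln ?posrE ?expR_gt0 ?expR_weighted//.
exact: lt_le_trans (expR_gt0 _) (expR_weighted b s0 s1).
Qed.

(** Comes from [expR b <= 1 / (1 - b)]; the condition [b <= 1/2] is what lets the coefficient 2
    absorb the cubic term. *)
Lemma expR_le_quad b : `|b| <= 2^-1 -> expR b <= 1 + b + 2 * b ^+ 2.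
Proof.
rewrite ler_norml => /andP[b1 b2].
have : 1 - b <= (expR b)^-1 by rewrite -expRN; exact: expR_ge1Dx.
move=> h; have e0 := expR_gt0 b.
have : expR b * (1 - b) <= 1.
  by have := ler_wpM2l (ltW e0) h; rewrite divff// gt_eqF.
have b3 : 1 - b > 0 by lra.
rewrite -ler_pdivlMr// => /le_trans; apply.
by rewrite ler_pdivrMr//; nra.
Qed.

Lemma softplus_upper a b : `|b| <= 2^-1 ->
  ln (1 + expR (a + b)) <= ln (1 + expR a) + sigmoid a * b + 2 * b ^+ 2.
Proof.
move=> hb; rewrite softplusD -addrA lerD2l.
have s0 := sigmoid_gt0 a; have s1 := sigmoid_lt1 a.
have eb := expR_gt0 b; have := expR_le_quad hb => h.
have : ln (1 + sigmoid a * (expR b - 1)) <= sigmoid a * (expR b - 1).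
  apply: le_ln1Dx; nra.
nra.
Qed.

Lemma logistic_loss_tangent y a b :
  logistic_loss y a + logistic_grad y a * b <= logistic_loss y (a + b).
Proof.
rewrite /logistic_loss /logistic_grad; case: y.
- rewrite !mul1r opprD; apply: le_trans (softplus_tangent _ _).
  by rewrite sigmoidN lerD2l; nra.
- by rewrite !mulN1r !opprK subr0; exact: softplus_tangent.
Qed.

Lemma logistic_loss_upper y a b : `|b| <= 2^-1 ->
  logistic_loss y (a + b) <=
  logistic_loss y a + logistic_grad y a * b + 2 * b ^+ 2.
Proof.
rewrite /logistic_loss /logistic_grad; case: y => hb.
- rewrite !mul1r opprD; apply: le_trans (softplus_upper _ _) _.
    by rewrite normrN.
  by rewrite sigmoidN; lra.
- by rewrite !mulN1r !opprK subr0; exact: softplus_upper.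
Qed.

(** The tangent inequality from either side, with slopes bounded by 1. *)
Lemma logistic_loss_lip y a b :
  `|logistic_loss y a - logistic_loss y b| <= `|a - b|.
Proof.
have key (c d : R) : logistic_loss y c - logistic_loss y d <= `|c - d|.
  have := logistic_loss_tangent y c (d - c).
  rewrite [c + (d - c)]addrC subrK => h.
  have : `|logistic_grad y c * (d - c)| <= `|c - d|.
    rewrite normrM (distrC d) ler_piMl//; exact: logistic_grad_le1.
  by rewrite ler_norml => /andP[]; lra.
rewrite ler_norml; have := key a b; have := key b a.
by rewrite (distrC b a) => *; apply/andP; split; lra.
Qed.

Lemma logistic_loss0 y : logistic_loss y (0 : R) = ln 2.
Proof. by rewrite /logistic_loss mulr0 oppr0 expR0. Qed.

Lemma logistic_loss_le y a : logistic_loss y a <= 1 + `|a|.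
Proof.
have := logistic_loss_lip y a 0.
rewrite subr0 ler_norml logistic_loss0 => /andP[_].
have : ln 2 <= (1:R) by apply: le_trans (le_ln1Dx _) _; lra.
lra.
Qed.

Lemma sigmoid_lip a b : `|sigmoid a - sigmoid b| <= `|a - b|.
Proof.
have key (c d : R) : c <= d -> 0 <= sigmoid d - sigmoid c <= d - c.
  move=> cd; rewrite /sigmoid.
  have ec := expR_gt0 (- c); have ed := expR_gt0 (- d).
  have h : expR (- d) <= expR (- c) by rewrite ler_expR; lra.
  have -> : 1 / (1 + expR (- d)) - 1 / (1 + expR (- c)) =
    (expR (- c) - expR (- d)) / ((1 + expR (- d)) * (1 + expR (- c))).
    field; rewrite !gt_eqF//; lra.
  have hp : 0 < (1 + expR (- d)) * (1 + expR (- c)) by nra.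
  apply/andP; split; first by rewrite divr_ge0//; lra.
  rewrite ler_pdivrMr//.
  have h2 : expR (- c) * (1 + (c - d)) <= expR (- d).
    rewrite [leRHS](_ : _ = expR (- c) * expR (c - d)).
      by rewrite ler_pM2l// expR_ge1Dx.
    by rewrite -expRD; congr expR; ring.
  nra.
wlog ab : a b / a <= b.
  move=> H; have [/H//|/ltW/H] := leP a b.
  by rewrite distrC (distrC b).
have /andP[h1 h2] := key _ _ ab.
by rewrite (distrC (sigmoid a)) (distrC a) !ger0_norm//; lra.
Qed.

Lemma mul_lnD_le p s : 0 <= p -> 0 < s -> p * ln s - p * ln p <= s - p.
Proof.
rewrite le0r => /orP[/eqP -> s0|p0 s0]; first by rewrite !mul0r; lra.
rewrite -mulrBr -ln_div ?posrE//.
have : ln (s / p) <= s / p - 1.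
  have := @le_ln1Dx R (s / p - 1).
  rewrite [1 + _]addrC subrK; apply.
  have : 0 < s / p by rewrite divr_gt0.
  lra.
move=> /(ler_wpM2l (ltW p0)) /le_trans; apply.
by rewrite mulrBr mulr1 mulrC divfK// gt_eqF.
Qed.

Lemma kl_lower p s : 0 <= p -> p <= 1 -> 0 < s -> s < 1 ->
  (p - s) ^+ 2 / 4 <= - (p * ln s) - (1 - p) * ln (1 - s) - binary_entropy p.
Proof.
move=> p0 p1 s0 s1; rewrite /binary_entropy.
(* [ln x <= x - 1] at the square roots bounds the divergence below by the
   squared Hellinger distance. *)
have key (q t : R) : 0 <= q -> 0 < t ->
    q * ln t - q * ln q <= 2 * (Num.sqrt q * Num.sqrt t - q).
  rewrite le0r => /orP[/eqP -> t0|q0 t0]; first by rewrite !mul0r sqrtr0 mul0r; lra.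
  have sq0 : 0 < Num.sqrt q by rewrite sqrtr_gt0.
  have st0 : 0 < Num.sqrt t by rewrite sqrtr_gt0.
  have Eq : q = Num.sqrt q ^+ 2 by rewrite sqr_sqrtr// ltW.
  have Et : t = Num.sqrt t ^+ 2 by rewrite sqr_sqrtr// ltW.
  have -> : ln t = 2 * ln (Num.sqrt t) by rewrite {1}Et expr2 lnM ?posrE//; lra.
  have -> : ln q = 2 * ln (Num.sqrt q) by rewrite {1}Eq expr2 lnM ?posrE//; lra.
  have h := @mul_lnD_le (Num.sqrt q) (Num.sqrt t) (ltW sq0) st0.
  have := ler_wpM2l (ltW sq0) h.
  rewrite {1 3 6}Eq; nra.
have h1 := key _ _ p0 s0.
have h2 := key (1 - p) (1 - s) ltac:(lra) ltac:(lra).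
set u := Num.sqrt p in h1 *; set v := Num.sqrt s in h1 *.
set u' := Num.sqrt (1 - p) in h2 *; set v' := Num.sqrt (1 - s) in h2 *.
have Ep : u ^+ 2 = p by rewrite sqr_sqrtr.
have Es : v ^+ 2 = s by rewrite sqr_sqrtr// ltW.
have Ep' : u' ^+ 2 = 1 - p by rewrite sqr_sqrtr//; lra.
have Es' : v' ^+ 2 = 1 - s by rewrite sqr_sqrtr//; lra.
have u0 : 0 <= u := sqrtr_ge0 _.
have v0 : 0 <= v := sqrtr_ge0 _.
have hl : (u - v) ^+ 2 <= - (p * ln s) - (1 - p) * ln (1 - s) -
   (- (p * ln p) - (1 - p) * ln (1 - p)).
  have : 0 <= (u' - v') ^+ 2 by exact: sqr_ge0.
  nra.
apply: le_trans hl; rewrite -Ep -Es.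
have u1 : u <= 1 by nra.
have v1 : v <= 1 by nra.
(* Here [p - s] factors as (u - v)(u + v) with [u + v <= 2], whence the constant 4. *)
have -> : (u ^+ 2 - v ^+ 2) ^+ 2 / 4 = (u - v) ^+ 2 * ((u + v) ^+ 2 / 4) by field.
by rewrite ler_piMr ?sqr_ge0//; nra.
Qed.

(** The divergence is at most the chi-square divergence, which for two Bernoulli laws is this
    quotient; termwise it is [ln x <= x - 1]. *)
Lemma kl_upper p s : 0 <= p -> p <= 1 -> 0 < s -> s < 1 ->
  - (p * ln s) - (1 - p) * ln (1 - s) - binary_entropy p <=
  (p - s) ^+ 2 / (s * (1 - s)).
Proof.
move=> p0 p1 s0 s1; rewrite /binary_entropy.
have key (q t : R) : 0 <= q -> 0 < t -> q * ln q - q * ln t <= q * (q / t - 1).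
  rewrite le0r => /orP[/eqP -> t0|q0 t0]; first by rewrite !mul0r subr0.
  rewrite -mulrBr -ln_div ?posrE// ler_pM2l//.
  have := @le_ln1Dx R (q / t - 1).
  rewrite [1 + _]addrC subrK; apply.
  have : 0 < q / t by rewrite divr_gt0.
  lra.
have h1 := key _ _ p0 s0.
have h2 := key (1 - p) (1 - s) ltac:(lra) ltac:(lra).
have -> : (p - s) ^+ 2 / (s * (1 - s)) =
  p * (p / s - 1) + (1 - p) * ((1 - p) / (1 - s) - 1).
  by field; rewrite !gt_eqF//; lra.
lra.
Qed.

Lemma excess_loss_lower p a : 0 <= p <= 1 ->
  (sigmoid a - p) ^+ 2 / 4 <=
  p * logistic_loss true a + (1 - p) * logistic_loss false a - binary_entropy p.
Proof.
move=> /andP[p0 p1]; rewrite !logistic_lossE.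
have := kl_lower p0 p1 (sigmoid_gt0 a) (sigmoid_lt1 a); lra.
Qed.

Lemma excess_loss_upper p a : 0 <= p <= 1 ->
  p * logistic_loss true a + (1 - p) * logistic_loss false a - binary_entropy p <=
  (sigmoid a - p) ^+ 2 / (sigmoid a * (1 - sigmoid a)).
Proof.
move=> /andP[p0 p1]; rewrite !logistic_lossE.
have := kl_upper p0 p1 (sigmoid_gt0 a) (sigmoid_lt1 a).
by rewrite -(sqrrN (p - _)) opprB; lra.
Qed.

Lemma sigmoid_logit s : 0 < s < 1 -> sigmoid (ln (s / (1 - s))) = s.
Proof.
move=> /andP[s0 s1]; rewrite /sigmoid.
have h : 0 < s / (1 - s) by rewrite divr_gt0//; lra.
rewrite expRN lnK ?posrE//.
by field; rewrite !gt_eqF//; lra.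
Qed.

End scalar.

(** * Expectations of bounded measurable functions *)

(** Bounded everywhere rather than integrable: the class is closed under products as well as sums,
    so linearity of the expectation applies to all expressions below. *)
Definition bounded_mfun (R : realType) (dT : measure_display)
    (T : measurableType dT) (f : T -> R) : Prop :=
  measurable_fun setT f /\ exists M : R, forall x, `|f x| <= M.

Section bounded_expectation.
Context {R : realType} {dT : measure_display} {T : measurableType dT}.
Variable P : probability T R.
Implicit Types (f g : T -> R) (A : set T).

Lemma bounded_mfun_cst (c : R) : bounded_mfun (fun _ : T => c).
Proof. by split; [exact: measurable_cst|exists `|c|]. Qed.

Lemma bounded_mfunD f g : bounded_mfun f -> bounded_mfun g ->
  bounded_mfun (fun x => f x + g x).
Proof.
move=> [mf [M hM]] [mg [N hN]]; split; first exact: measurable_funD.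
by exists (M + N) => x; rewrite (le_trans (ler_normD _ _))// lerD.
Qed.

Lemma bounded_mfunM f g : bounded_mfun f -> bounded_mfun g ->
  bounded_mfun (fun x => f x * g x).
Proof.
move=> [mf [M hM]] [mg [N hN]]; split; first exact: measurable_funM.
by exists (M * N) => x; rewrite normrM ler_pM.
Qed.

Lemma bounded_mfunZ (c : R) f : bounded_mfun f -> bounded_mfun (fun x => c * f x).
Proof. exact: bounded_mfunM (bounded_mfun_cst c). Qed.

Lemma bounded_mfunB f g : bounded_mfun f -> bounded_mfun g ->
  bounded_mfun (fun x => f x - g x).
Proof.
move=> bf /(bounded_mfunZ (-1)) /(bounded_mfunD bf).
by under eq_fun do rewrite mulN1r.
Qed.

Lemma bounded_mfun_indic A : measurable A -> bounded_mfun (\1_A : T -> R).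
Proof.
move=> mA; split; first exact: measurable_indic.
by exists 1 => x; rewrite indicE; case: (_ \in _); rewrite ?normr1 ?normr0.
Qed.

Lemma bounded_mfun_sum (I : finType) (F : I -> T -> R) :
  (forall i, bounded_mfun (F i)) -> bounded_mfun (fun x => \sum_i F i x).
Proof.
move=> bF; elim: (index_enum I) => [|i s IH].
  by under eq_fun do rewrite big_nil; exact: (bounded_mfun_cst 0).
by under eq_fun do rewrite big_cons; exact: bounded_mfunD.
Qed.

Lemma bounded_mfun_integrable f : bounded_mfun f ->
  P.-integrable setT (EFin \o f).
Proof.
move=> [mf [M hM]]; apply: measurable_bounded_integrable => //.
  exact: le_lt_trans (probability_le1 P measurableT) (ltry _).
exists M; split; first by rewrite num_real.
by move=> t Mt x _ /=; apply: le_trans (hM x) (ltW Mt).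
Qed.

Lemma expect_cst (c : R) : \int[P]_x c = c.
Proof.
rewrite Rintegral_cst// -[RHS]mulr1; congr (_ * _).
by rewrite -[RHS]/(fine 1%E); congr fine; exact: probability_setT.
Qed.

Lemma expectD f g : bounded_mfun f -> bounded_mfun g ->
  \int[P]_x (f x + g x) = \int[P]_x f x + \int[P]_x g x.
Proof. by move=> bf bg; rewrite RintegralD//; exact: bounded_mfun_integrable. Qed.

Lemma expectB f g : bounded_mfun f -> bounded_mfun g ->
  \int[P]_x (f x - g x) = \int[P]_x f x - \int[P]_x g x.
Proof. by move=> bf bg; rewrite RintegralB//; exact: bounded_mfun_integrable. Qed.

Lemma expectZ (c : R) f : bounded_mfun f ->
  \int[P]_x (c * f x) = c * \int[P]_x f x.
Proof. by move=> bf; rewrite RintegralZl//; exact: bounded_mfun_integrable. Qed.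

Lemma expect_le f g : bounded_mfun f -> bounded_mfun g ->
  (forall x, f x <= g x) -> \int[P]_x f x <= \int[P]_x g x.
Proof. by move=> bf bg fg; apply: le_Rintegral => //; exact: bounded_mfun_integrable. Qed.

Lemma expect_indic A : measurable A -> \int[P]_x \1_A x = fine (P A).
Proof. by move=> mA; rewrite /Rintegral integral_indic// setIT. Qed.

Lemma expect_sum (I : finType) (F : I -> T -> R) :
  (forall i, bounded_mfun (F i)) ->
  \int[P]_x (\sum_i F i x) = \sum_i \int[P]_x F i x.
Proof.
move=> bF.
have bS (s : seq I) : bounded_mfun (fun x => \sum_(i <- s) F i x).
  elim: s => [|i s IH].
    by under eq_fun do rewrite big_nil; exact: (bounded_mfun_cst 0).
  by under eq_fun do rewrite big_cons; exact: bounded_mfunD.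
elim: (index_enum I) => [|i s IH].
  by under eq_Rintegral do rewrite big_nil; rewrite expect_cst big_nil.
rewrite big_cons -IH -expectD//.
by apply: eq_Rintegral => x _; rewrite big_cons.
Qed.

Lemma expect_norm_le f : bounded_mfun f -> `|\int[P]_x f x| <= \int[P]_x `|f x|.
Proof. by move=> bf; apply: le_normr_Rintegral => //; exact: bounded_mfun_integrable. Qed.

Lemma bounded_mfun_norm f : bounded_mfun f -> bounded_mfun (fun x => `|f x|).
Proof.
move=> [mf [M hM]]; split; first exact: measurableT_comp.
by exists M => x; rewrite normr_id.
Qed.

Lemma measurable_ge f (r : R) : measurable_fun setT f ->
  measurable [set x | r <= f x].
Proof.
move=> mf; rewrite -[X in measurable X]setTI.
rewrite (_ : [set x | r <= f x] = f @^-1` `[r, +oo[%classic); first exact: mf.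
by apply/seteqP; split => x /=; rewrite in_itv/= andbT.
Qed.

Lemma markov_bounded f (r : R) : bounded_mfun f -> (forall x, 0 <= f x) -> 0 < r ->
  fine (P [set x | r <= f x]) <= (\int[P]_x f x) / r.
Proof.
move=> bf f0 r0; rewrite ler_pdivlMr// mulrC.
have mA : measurable [set x | r <= f x] by apply: measurable_ge; case: bf.
rewrite -expect_indic// -expectZ; last exact: bounded_mfun_indic.
apply: expect_le => //; first exact/bounded_mfunZ/bounded_mfun_indic.
move=> x; rewrite indicE; case: (boolP (x \in _)); last by rewrite mulr0.
by rewrite inE/= mulr1.
Qed.

End bounded_expectation.

(** * Empirical frequencies *)

Section empirical_frequencies.
Context {R : realType} {dO dT : measure_display}.
Context {Omega : measurableType dO} {T : measurableType dT}.
Variables (Pr : probability Omega R) (V : nat -> Omega -> T).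
Variable nu : set T -> \bar R.

(** The form in which independence enters second-moment computations. [nu] is a bare set function,
    so that both a probability and a pushforward can be the common law. *)
Definition pairwise_iid : Prop :=
  [/\ forall i, measurable_fun setT (V i),
      forall i A, measurable A -> Pr (V i @^-1` A) = nu A &
      forall i j A B, i != j -> measurable A -> measurable B ->
        Pr (V i @^-1` A `&` V j @^-1` B) = (nu A * nu B)%E].

Definition freq_dev (m : nat) (A : set T) (w : Omega) : R :=
  m%:R^-1 * \sum_(i < m) (\1_A (V i w) - fine (nu A)).

Hypothesis iidV : pairwise_iid.

Let mV i (A : set T) : measurable A -> measurable (V i @^-1` A).
Proof.
by case: iidV => mV _ _ mA; rewrite -[X in measurable X]setTI; exact: mV.
Qed.

Let indV i (A : set T) : (fun w => \1_A (V i w) : R) = \1_(V i @^-1` A).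
Proof. by apply/funext => w; rewrite !indicE; congr ((_ : bool)%:R); apply/idP/idP; rewrite !inE. Qed.

Let nu_fin (A : set T) : measurable A -> nu A \is a fin_num.
Proof.
case: iidV => _ h _ mA; rewrite -(h 0%N A mA); exact: (fin_num_measure Pr _ (mV 0 mA)).
Qed.

Let bindV i (A : set T) : measurable A -> bounded_mfun (fun w => \1_A (V i w) : R).
Proof. by move=> mA; rewrite indV; apply/bounded_mfun_indic/mV. Qed.

Let expV i (A : set T) : measurable A ->
  \int[Pr]_w (\1_A (V i w) : R) = fine (nu A).
Proof.
move=> mA; rewrite indV expect_indic; last exact: mV.
by case: iidV => _ h _; rewrite h.
Qed.

Let bterm i (A : set T) : measurable A ->
  bounded_mfun (fun w => \1_A (V i w) - fine (nu A) : R).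
Proof. by move=> mA; apply: bounded_mfunB; [exact: bindV|exact: bounded_mfun_cst]. Qed.

Lemma bounded_freq_dev m (A : set T) : measurable A -> bounded_mfun (freq_dev m A).
Proof. by move=> mA; apply: bounded_mfunZ; apply: bounded_mfun_sum => i; exact: bterm. Qed.

Lemma indicator_cov i j (A B : set T) : measurable A -> measurable B ->
  \int[Pr]_w ((\1_A (V i w) - fine (nu A)) * (\1_B (V j w) - fine (nu B))) =
  if i == j then fine (nu (A `&` B)) - fine (nu A) * fine (nu B) else 0.
Proof.
move=> mA mB.
set p := fine (nu A); set q := fine (nu B).
have -> : (fun w => (\1_A (V i w) - p) * (\1_B (V j w) - q) : R) =
   (fun w => (\1_A (V i w) * \1_B (V j w) - q * \1_A (V i w)) -
             (p * \1_B (V j w) - p * q)).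
  by apply/funext => w; ring.
have bA := bindV i mA; have bB := bindV j mB.
have bAB := bounded_mfunM bA bB.
rewrite expectB; [|exact/bounded_mfunB/bounded_mfunZ|
  by apply: bounded_mfunB; [exact: bounded_mfunZ|exact: bounded_mfun_cst]].
rewrite expectB//; last exact: bounded_mfunZ.
rewrite expectB; [|exact: bounded_mfunZ|exact: bounded_mfun_cst].
rewrite (expectZ Pr q bA) (expectZ Pr p bB) !expV// expect_cst -/p -/q.
have -> : (fun w => \1_A (V i w) * \1_B (V j w) : R) =
    \1_(V i @^-1` A `&` V j @^-1` B).
  rewrite indicI; apply/funext => w /=.
  by have := congr1 (@^~ w) (indV i A); have := congr1 (@^~ w) (indV j B) => /= -> ->.
rewrite expect_indic; last by apply: measurableI; exact: mV.
case: eqP => [<-|/eqP ij].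
  rewrite -preimage_setI.
  case: iidV => _ -> // => [_|]; last exact: measurableI.
  ring.
case: iidV => _ _ ->//; rewrite fineM ?nu_fin// -/p -/q; ring.
Qed.

(** Of the m^2 pairs of samples only the [m] diagonal ones contribute. *)
Lemma freq_dev_cov m (A B : set T) : (0 < m)%N -> measurable A -> measurable B ->
  \int[Pr]_w (freq_dev m A w * freq_dev m B w) =
  (fine (nu (A `&` B)) - fine (nu A) * fine (nu B)) / m%:R.
Proof.
move=> m0 mA mB.
have -> : (fun w => freq_dev m A w * freq_dev m B w) =
  (fun w => (m%:R^-1 * m%:R^-1) * \sum_(i < m) \sum_(j < m)
     ((\1_A (V i w) - fine (nu A)) * (\1_B (V j w) - fine (nu B)))).
  apply/funext => w; rewrite /freq_dev mulrACA; congr (_ * _).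
  by rewrite mulr_suml; apply: eq_bigr => i _; rewrite mulr_sumr.
have bt i j : bounded_mfun (fun w =>
    (\1_A (V i w) - fine (nu A)) * (\1_B (V j w) - fine (nu B)) : R).
  by apply: bounded_mfunM; exact: bterm.
rewrite expectZ; last by apply: bounded_mfun_sum => i; exact: bounded_mfun_sum.
rewrite expect_sum; last by move=> i; exact: bounded_mfun_sum.
under eq_bigr => i _.
  rewrite expect_sum//; under eq_bigr => j _ do rewrite indicator_cov//.
  rewrite (bigD1 i)//= eqxx big1 ?addr0; last first.
    by move=> j ji; rewrite eq_sym (negbTE (_ : (j : nat) != i))//.
  over.
rewrite /= sumr_const card_ord -mulr_natl.
have m0' : (m%:R : R) != 0 by rewrite pnatr_eq0 -lt0n.
by field.
Qed.

Section quadratic_form.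
Variables (I : finType) (C : I -> set T) (w : I -> I -> R).
Hypothesis mC : forall c, measurable (C c).
Hypothesis dC : forall c c', c != c' -> C c `&` C c' = set0.
Hypothesis psd : forall x : I -> R, 0 <= \sum_c \sum_c' x c * x c' * w c c'.

Let bquad m : bounded_mfun (fun o =>
  \sum_c \sum_c' freq_dev m (C c) o * freq_dev m (C c') o * w c c').
Proof.
apply: bounded_mfun_sum => c; apply: bounded_mfun_sum => c'.
by apply: bounded_mfunM (bounded_mfun_cst _); apply: bounded_mfunM; exact: bounded_freq_dev.
Qed.

Lemma measurable_freq_quad m r : measurable [set o | r <=
  \sum_c \sum_c' freq_dev m (C c) o * freq_dev m (C c') o * w c c'].
Proof. by apply: measurable_ge; case: (bquad m). Qed.

(* The covariance of the frequencies of disjoint cells is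
   [(diag p - p p^T) / m], and the rank-one part only decreases the form. *)
Lemma freq_quad_tail m r M : (0 < m)%N -> 0 < r -> 0 <= M ->
  (forall c, w c c <= M) ->
  fine (Pr [set o | r <=
    \sum_c \sum_c' freq_dev m (C c) o * freq_dev m (C c') o * w c c'])
  <= M / (m%:R * r).
Proof.
move=> m0 r0 M0 wM.
apply: le_trans (markov_bounded Pr (bquad m) _ r0) _; first by move=> o; exact: psd.
have mr0 : 0 < (m%:R : R) by rewrite ltr0n.
rewrite invfM mulrA ler_pM2r ?invr_gt0//.
rewrite expect_sum; last first.
  move=> c; apply: bounded_mfun_sum => c'.
  by apply: bounded_mfunM (bounded_mfun_cst _); apply: bounded_mfunM; exact: bounded_freq_dev.
have bq c c' : bounded_mfun (fun o => freq_dev m (C c) o * freq_dev m (C c') o).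
  by apply: bounded_mfunM; exact: bounded_freq_dev.
pose p c := fine (nu (C c)).
have -> : \sum_c \int[Pr]_x (\sum_c' freq_dev m (C c) x * freq_dev m (C c') x * w c c')
  = (\sum_c p c * w c c - \sum_c \sum_c' p c * p c' * w c c') / m%:R.
  rewrite -sumrB mulr_suml; apply: eq_bigr => c _.
  rewrite expect_sum; last first.
    by move=> c'; apply: bounded_mfunM (bounded_mfun_cst _).
  under eq_bigr => c' _.
    rewrite (_ : (fun o => _) = fun o => w c c' * (freq_dev m (C c) o * freq_dev m (C c') o)); last first.
      by apply/funext => o; rewrite mulrC.
    rewrite expectZ// freq_dev_cov//.
    over.
  rewrite /= [X in X - _](_ : _ = \sum_c' (if c' == c then p c * w c c else 0)); last first.
    by rewrite -big_mkcond/= big_pred1_eq.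
  rewrite -sumrB mulr_suml; apply: eq_bigr => c' _.
  have [->|c'c] := eqVneq c' c; first by rewrite setIid -/(p c); ring.
  rewrite dC 1?eq_sym//.
  have -> : fine (nu set0) = 0.
    by case: iidV => _ h _; rewrite -(h 0%N set0 measurable0) preimage_set0 measure0.
  rewrite -/(p c) -/(p c'); ring.
rewrite ler_pM2r ?invr_gt0//.
have p0 c : 0 <= p c.
  by rewrite /p; case: iidV => _ h _; rewrite -(h 0%N _ (mC c)) fine_ge0.
(* Since [nu] is only a set function, the total mass of the disjoint cells is bounded through the
   law of the sample [V 0]. *)
have p1 : \sum_c p c <= 1.
  rewrite /p; under eq_bigr => c _ do rewrite -(expV 0%N (mC c)).
  rewrite -expect_sum; last by move=> c; exact: bindV.
  rewrite -[leRHS](expect_cst Pr); apply: expect_le.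
  - by apply: bounded_mfun_sum => c; exact: bindV.
  - exact: bounded_mfun_cst.
  move=> o; have [/existsP[c hc]|] := boolP [exists c, V 0%N o \in C c].
    rewrite (bigD1 c)//= big1 ?addr0; last first.
      move=> c' c'c; rewrite indicE; case: (boolP (_ \in _)) => // hc'.
      have : (C c' `&` C c) (V 0%N o) by split; apply/set_mem.
      by rewrite dC.
    by rewrite indicE hc.
  rewrite negb_exists => /forallP h; rewrite big1// => c _.
  by rewrite indicE (negbTE (h c)).
apply: le_trans (_ : \sum_c p c * w c c <= _).
  by rewrite lerBlDr lerDl; exact: psd.
apply: le_trans (_ : \sum_c p c * M <= _).
  by apply: ler_sum => c _; exact: ler_wpM2l.
by rewrite -mulr_suml ler_piMl.
Qed.

End quadratic_form.

(** Chebyshev's inequality, as the quadratic form of a single cell with weight 1. *)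
Lemma freq_dev_tail m r (A : set T) : (0 < m)%N -> 0 < r -> measurable A ->
  measurable [set o | r <= freq_dev m A o ^+ 2] /\
  fine (Pr [set o | r <= freq_dev m A o ^+ 2]) <= 1 / (m%:R * r).
Proof.
move=> m0 r0 mA.
have d1 (c c' : 'I_1) : c != c' -> A `&` A = set0 by rewrite !ord1.
have := @freq_quad_tail 'I_1 (fun=> A) (fun _ _ => 1) (fun=> mA) d1
  _ m r 1 m0 r0 ler01 (fun=> lexx _).
have := @measurable_freq_quad 'I_1 (fun=> A) (fun _ _ => 1) (fun=> mA) m r.
under eq_set do rewrite !big_ord1 mulr1 -expr2.
move=> h1 h2; split=> //; apply: h2 => x.
by rewrite !big_ord1 mulr1 -expr2 sqr_ge0.
Qed.

End empirical_frequencies.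

(** * Pairwise laws of the two samples *)

Section samples.
Context {R : realType} {d : nat} {dO : measure_display} {Omega : measurableType dO}.
Variables (Pr : probability Omega R) (Z : nat -> Omega -> (Rd R d * bool)%type).
Variables (W : nat -> Omega -> Rd R d).
Variables (P Q : probability (Rd R d * bool)%type R).
Hypothesis iid : two_iid_samples Pr Z W P (pushforward Q fst).

Let prod_pair (S : Type) (nu : set S -> \bar R) (i j m : nat) (A B : set S) :
  nu setT = 1%E -> i != j -> (i < m)%N -> (j < m)%N ->
  (\prod_(l < m) nu (if (l : nat) == i then A else if (l : nat) == j then B else setT))%E
   = (nu A * nu B)%E.
Proof.
move=> nT ij im jm.
rewrite (bigD1 (Ordinal im))//= eqxx (bigD1 (Ordinal jm))/=; last first.
  by rewrite -val_eqE/= eq_sym.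
rewrite eqxx eq_sym (negbTE ij) big1 ?mule1//.
by move=> l /andP[li lj]; rewrite !ifN//.
Qed.

(** Marginalization: with [setT] for every other coordinate, only the factors of interest remain in
    the product formula. *)
Lemma two_iid_samplesZ : pairwise_iid Pr Z P.
Proof.
case: iid => mZ mW h; split=> //.
  move=> i A mA.
  have := h i.+1 0%N (fun l => if l == i then A else setT) (fun=> setT).
  rewrite big_ord0 mule1 big_ord_recr/= eqxx big1; last first.
    by move=> l _; rewrite ltn_eqF// probability_setT.
  rewrite mul1e => <-//; last by move=> l; case: ifP.
  congr (Pr _); apply/seteqP; split => [w/= Aw|w/= [+ _]].
    by split=> // l li; case: eqP => // ->.
  by move=> /(_ i (ltnSn i)); rewrite eqxx.
move=> i j A B ij mA mB.
have := h (maxn i j).+1 0%N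
  (fun l => if l == i then A else if l == j then B else setT) (fun=> setT).
rewrite big_ord0 mule1 prod_pair//; last 3 first.
- exact: probability_setT.
- by rewrite ltnS leq_maxl.
- by rewrite ltnS leq_maxr.
move=> <-//; last by move=> l; do 2 case: ifP => //.
congr (Pr _); apply/seteqP; split => [w/= [Aw Bw]|w/= [+ _]].
  by split=> // l li; case: eqP => [->//|_]; case: eqP => [->//|_].
move=> H; split.
  by have := H i; rewrite eqxx; apply; rewrite ltnS leq_maxl.
by have := H j; rewrite eqxx eq_sym (negbTE ij); apply; rewrite ltnS leq_maxr.
Qed.

Lemma two_iid_samplesW : pairwise_iid Pr W (pushforward Q fst).
Proof.
have nT : pushforward Q fst (setT : set (Rd R d)) = 1%E.
  by rewrite /pushforward preimage_setT; exact: probability_setT.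
case: iid => mZ mW h; split=> //.
  move=> i A mA.
  have := h 0%N i.+1 (fun=> setT) (fun l => if l == i then A else setT).
  rewrite big_ord0 mul1e big_ord_recr/= eqxx big1; last first.
    by move=> l _; rewrite ltn_eqF.
  rewrite mul1e => <-//; last by move=> l; case: ifP.
  congr (Pr _); apply/seteqP; split => [w/= Aw|w/= [_ +]].
    by split=> // l li; case: eqP => // ->.
  by move=> /(_ i (ltnSn i)); rewrite eqxx.
move=> i j A B ij mA mB.
have := h 0%N (maxn i j).+1 (fun=> setT)
  (fun l => if l == i then A else if l == j then B else setT).
rewrite big_ord0 mul1e prod_pair//; last 2 first.
- by rewrite ltnS leq_maxl.
- by rewrite ltnS leq_maxr.
move=> <-//; last by move=> l; do 2 case: ifP => //.
congr (Pr _); apply/seteqP; split => [w/= [Aw Bw]|w/= [_ +]].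
  by split=> // l li; case: eqP => [->//|_]; case: eqP => [->//|_].
move=> H; split.
  by have := H i; rewrite eqxx; apply; rewrite ltnS leq_maxl.
by have := H j; rewrite eqxx eq_sym (negbTE ij); apply; rewrite ltnS leq_maxr.
Qed.

End samples.

(** * Reproducing kernel Hilbert spaces *)

(** Makes compact sets closed, hence Borel. Distinct vectors differ in some coordinate, and disjoint
    intervals there give disjoint balls of vectors. *)
Lemma rV_hausdorff (R : realType) (d : nat) : hausdorff_space 'rV[R]_d.
Proof.
rewrite ball_hausdorff => a b ab.
have [j abj] : exists j, a 0 j != b 0 j.
  apply/existsP; rewrite -negb_forall; apply: contra ab => /forallP h.
  by apply/eqP/rowP => j; exact/eqP.
have := @Rhausdorff R; rewrite ball_hausdorff => /(_ _ _ abj)[r /eqP r0].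
exists r; apply/eqP; rewrite -subset0 => x [[_ xa] [_ xb]].
suff : set0 (x 0 j) by [].
by rewrite -r0; split; [exact: xa|exact: xb].
Qed.

Lemma open_Rd_measurable (R : realType) (d : nat) (U : set 'rV[R]_d) :
  open U -> measurable (U : set (Rd R d)).
Proof. by move=> oU; exact: sub_sigma_algebra. Qed.

Lemma compact_Rd_measurable (R : realType) (d : nat) (X : set 'rV[R]_d) :
  compact X -> measurable (X : set (Rd R d)).
Proof.
move=> /(compact_closed (@rV_hausdorff R d)) cX.
rewrite -[X in measurable X]setCK; apply: measurableC.
by apply: open_Rd_measurable; rewrite openC.
Qed.

Section rkhs.
Context {R : realType} {d : nat}.
Local Notation V := 'rV[R]_d.
Variables (X : set V) (k : V -> V -> R) (H : set (V -> R)).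
Variable ip : (V -> R) -> (V -> R) -> R.
Hypotheses (kpd : pd_kernel X k) (rkhsH : is_RKHS X k H ip).
Implicit Types (f g h : V -> R) (x y : V).

Definition rkhs_norm f := Num.sqrt (ip f f).

Lemma rkhsD f g : H f -> H g -> H (fun x => f x + g x).
Proof. by case: rkhsH => _ [+ _]; exact. Qed.

Lemma rkhsZ (a : R) f : H f -> H (fun x => a * f x).
Proof. by case: rkhsH => _ [_ [+ _]]; exact. Qed.

Lemma rkhsB f g : H f -> H g -> H (fun x => f x - g x).
Proof.
move=> Hf /(rkhsZ (-1)) /(rkhsD Hf).
by under eq_fun do rewrite mulN1r.
Qed.

Lemma rkhs0 : H (fun=> 0). Proof. by case: rkhsH. Qed.

Lemma rkhs_off f x : H f -> ~ X x -> f x = 0.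
Proof. by case: rkhsH => _ [_ [_ [+ _]]] => h /h; exact. Qed.

Lemma ipDl f g h : H f -> H g -> H h -> ip (fun x => f x + g x) h = ip f h + ip g h.
Proof. by case: rkhsH => _ [_ [_ [_ [+ _]]]]; exact. Qed.

Lemma ipZl (a : R) f g : H f -> H g -> ip (fun x => a * f x) g = a * ip f g.
Proof. by case: rkhsH => _ [_ [_ [_ [_ [+ _]]]]]; exact. Qed.

Lemma ipC f g : H f -> H g -> ip f g = ip g f.
Proof. by case: rkhsH => _ [_ [_ [_ [_ [_ [+ _]]]]]]; exact. Qed.

Lemma ip_ge0 f : H f -> 0 <= ip f f.
Proof. by case: rkhsH => _ [_ [_ [_ [_ [_ [_ [+ _]]]]]]]; exact. Qed.

Lemma ip_eq0 f : H f -> ip f f = 0 -> f = fun=> 0.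
Proof. by case: rkhsH => _ [_ [_ [_ [_ [_ [_ [_ [+ _]]]]]]]]; exact. Qed.

Lemma rkhs_ksec x : X x -> H (ksec X k x).
Proof. by case: rkhsH => _ [_ [_ [_ [_ [_ [_ [_ [_ [_ +]]]]]]]]] => h /h[]. Qed.

Lemma reproducing f x : H f -> X x -> f x = ip f (ksec X k x).
Proof. by case: rkhsH => _ [_ [_ [_ [_ [_ [_ [_ [_ [_ +]]]]]]]]] => h Hf /h[_]; exact. Qed.

Lemma ipDr f g h : H f -> H g -> H h -> ip h (fun x => f x + g x) = ip h f + ip h g.
Proof. by move=> Hf Hg Hh; rewrite ipC ?ipDl//; [rewrite (ipC Hf)// (ipC Hg)|exact: rkhsD]. Qed.

Lemma ipZr (a : R) f g : H f -> H g -> ip g (fun x => a * f x) = a * ip g f.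
Proof. by move=> Hf Hg; rewrite ipC ?ipZl//; [rewrite (ipC Hf)|exact: rkhsZ]. Qed.

Lemma ip_quad f g (s : R) : H f -> H g ->
  ip (fun x => f x + s * g x) (fun x => f x + s * g x) =
  ip f f + 2 * s * ip f g + s ^+ 2 * ip g g.
Proof.
move=> Hf Hg; have Hsg := rkhsZ s Hg.
rewrite ipDl//; last exact: rkhsD.
rewrite !ipDr// !ipZr// !ipZl// (ipC Hg)//; ring.
Qed.

Lemma ip_subE f g : H f -> H g ->
  ip (fun x => f x - g x) (fun x => f x - g x) = ip f f - 2 * ip f g + ip g g.
Proof.
move=> Hf Hg; have := ip_quad (-1) Hf Hg.
under [fun x => f x + _]eq_fun do rewrite mulN1r.
by move=> ->; ring.
Qed.

Lemma rkhs_norm_ge0 f : 0 <= rkhs_norm f.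
Proof. exact: sqrtr_ge0. Qed.

Lemma rkhs_norm_sqr f : H f -> rkhs_norm f ^+ 2 = ip f f.
Proof. by move=> Hf; rewrite sqr_sqrtr// ip_ge0. Qed.

Lemma rkhs_cauchy_schwarz f g : H f -> H g ->
  `|ip f g| <= rkhs_norm f * rkhs_norm g.
Proof.
move=> Hf Hg; rewrite -sqrtrM ?ip_ge0// -sqrtr_sqr ler_wsqrtr//.
have a0 := ip_ge0 Hf; have b0 := ip_ge0 Hg.
have [b00|bn0] := eqVneq (ip g g) 0.
  suff -> : ip f g = 0 by rewrite b00 mulr0 expr0n.
  rewrite (ip_eq0 Hg b00).
  by have := ipZr 0 rkhs0 Hf; under eq_fun do rewrite mul0r; rewrite mul0r.
have bp : 0 < ip g g by rewrite lt_neqAle eq_sym bn0.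
have := ip_ge0 (rkhsD Hf (rkhsZ (- ip f g / ip g g) Hg)).
rewrite ip_quad// => h.
have := mulr_ge0 (ltW bp) h.
set a := ip f f; set b := ip g g; set c := ip f g.
suff -> : b * (a + 2 * (- c / b) * c + (- c / b) ^+ 2 * b) = a * b - c ^+ 2 by rewrite subr_ge0.
by field.
Qed.

Lemma rkhs_norm_eq0 f : H f -> rkhs_norm f = 0 -> f = fun=> 0.
Proof. by move=> Hf f0; apply: ip_eq0 => //; rewrite -rkhs_norm_sqr// f0 expr0n. Qed.

Lemma ip_ksec x y : X x -> X y -> ip (ksec X k x) (ksec X k y) = k x y.
Proof.
move=> Xx Xy; rewrite -reproducing//; last exact: rkhs_ksec.
by rewrite /ksec asboolT.
Qed.

Lemma rkhs_eval_le f x : H f -> X x -> `|f x| <= rkhs_norm f * Num.sqrt (k x x).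
Proof.
move=> Hf Xx; rewrite {1}(reproducing Hf Xx).
apply: le_trans (rkhs_cauchy_schwarz Hf (rkhs_ksec Xx)) _.
by rewrite [X in _ * X]/rkhs_norm ip_ksec.
Qed.

(** The square root is the RKHS distance between the kernel sections at [x] and [y], so every member
    of [H] is Lipschitz for this kernel distance. *)
Lemma rkhs_eval_sub_le f x y : H f -> X x -> X y ->
  `|f x - f y| <= rkhs_norm f * Num.sqrt (k x x - 2 * k y x + k y y).
Proof.
move=> Hf Xx Xy; have Hx := rkhs_ksec Xx; have Hy := rkhs_ksec Xy.
have Hxy := rkhsB Hx Hy.
rewrite (reproducing Hf Xx) (reproducing Hf Xy).
have -> : ip f (ksec X k x) - ip f (ksec X k y) =
    ip f (fun z => ksec X k x z - ksec X k y z).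
  have := ipDr Hx (rkhsZ (-1) Hy) Hf; rewrite ipZr// mulN1r => <-.
  by under eq_fun do rewrite mulN1r.
apply: le_trans (rkhs_cauchy_schwarz Hf Hxy) _.
rewrite [X in _ * X]/rkhs_norm ip_subE// !ip_ksec//.
by case: kpd => _ -> .
Qed.

(** The squared kernel distance equals (k x x - k a a) - 2 (k a x - k a a), so continuity at the
    single point [(a, a)] gives the bound. *)
Lemma kernel_oscillation a (r : R) : X a -> 0 < r ->
  exists U : set V, [/\ open U, U a &
    forall x, X x -> U x -> k x x - 2 * k a x + k a a <= r].
Proof.
move=> Xa r0; case: kpd => /subspace_continuousP kc _ _.
have XXa : (X `*` X) (a, a) by split.
have := kc _ XXa => /cvgrPdist_lt /(_ (r / 4)) => /(_ ltac:(lra)).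
rewrite /= near_withinE/= => -[[A B] /= [Aa Ba] AB].
have nU : nbhs a (A `&` B) by exact: filterI.
move: nU; rewrite nbhsE => -[U [oU Ua] UAB].
exists U; split=> // x Xx Ux.
have [Ax Bx] := UAB _ Ux; have [Aa' Ba'] := UAB _ Ua.
have /(_ (conj Xx Xx)) := AB (x, x) (conj Ax Bx).
have /(_ (conj Xa Xx)) := AB (a, x) (conj Aa' Bx).
by rewrite /from_subspace/= !ltr_norml => /andP[? ?] /andP[? ?]; lra.
Qed.

Hypothesis cX : compact X.

(** Neighbourhoods of small kernel radius cover [X]; compactness keeps finitely many and [seqDU]
    makes them disjoint. The centre [c i] lies in [X] but possibly outside its own cell [A i]. *)
Lemma kernel_partition (rho : R) : 0 < rho ->
  exists (N : nat) (c : 'I_N -> V) (A : 'I_N -> set (Rd R d)),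
  [/\ forall i, measurable (A i),
      forall i j, i != j -> A i `&` A j = set0,
      forall i, X (c i),
      forall x, X x -> exists i, A i x &
      forall i x, A i x ->
        X x /\ Num.sqrt (k x x - 2 * k (c i) x + k (c i) (c i)) <= rho].
Proof.
move=> rho0; have r20 : 0 < rho ^+ 2 by rewrite exprn_gt0.
have [f hf] : {f : V -> set V & forall a, X a -> [/\ open (f a), f a a &
    forall x, X x -> f a x -> k x x - 2 * k a x + k a a <= rho ^+ 2]}.
  apply: (@choice _ _ (fun a U => X a -> [/\ open U, U a &
    forall x, X x -> U x -> k x x - 2 * k a x + k a a <= rho ^+ 2])) => a.
  have [Xa|nXa] := pselect (X a); last by exists set0.
  by have [U hU] := kernel_oscillation Xa r20; exists U.
have := cX; rewrite compact_cover => /(_ V X f).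
case=> [a /hf[]//|x Xx|D' D'X XD']; first by exists x => //; have [] := hf _ Xx.
pose s : seq V := finmap.enum_fset D'.
have sX i : (i < size s)%N -> X (nth 0 s i).
  by move=> i_s; apply/set_mem/D'X; exact: mem_nth.
(* [seqDU] takes a sequence over all naturals: past the end of the list the sets are empty. *)
pose F i := X `&` (if (i < size s)%N then f (nth 0 s i) else set0) : set (Rd R d).
have mX := compact_Rd_measurable cX.
have mF i : measurable (F i).
  apply: measurableI => //; case: ifPn => // i_s.
  by apply: open_Rd_measurable; have [] := hf _ (sX _ i_s).
exists (size s), (fun i => nth 0 s i), (fun i => seqDU F i); split.
- by move=> i; exact: seqDU_measurable.
- move=> i j ij; have /trivIsetP := @trivIset_seqDU _ F; apply=> //.
- by move=> i; exact: sX.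
- move=> x Xx; have [a aD fax] := XD' _ Xx.
  have : (\big[setU/set0]_(i < size s) F i) x.
    have a_s : (index a s < size s)%N by rewrite index_mem.
    rewrite -bigcup_mkord; exists (index a s) => //; split=> //.
    by rewrite a_s nth_index.
  by rewrite bigsetU_seqDU -bigcup_mkord => -[i /= i_s] h; exists (Ordinal i_s).
- move=> i x hx; have [Xx] := @subset_seqDU _ F i x hx; rewrite ltn_ord => fx; split=> //.
  rewrite -(ger0_norm (ltW rho0)) -sqrtr_sqr ler_wsqrtr//.
  by have [_ _] := hf _ (sX _ (ltn_ord i)); apply.
Qed.

(** The triangle inequality in [H]: a section lies within 1 of the section at some centre. The sum
    over centres stands in for their maximum. *)
Lemma kernel_bound : exists2 K : R, 1 <= K & forall x, X x -> Num.sqrt (k x x) <= K.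
Proof.
have [N [c [A [_ _ Xc covX oscA]]]] := kernel_partition ltr01.
exists (1 + \sum_i Num.sqrt (k (c i) (c i))).
  by rewrite lerDl; apply: sumr_ge0 => i _; exact: sqrtr_ge0.
move=> x Xx; have [i Aix] := covX _ Xx; have [_ h] := oscA _ _ Aix.
apply: le_trans (_ : 1 + Num.sqrt (k (c i) (c i)) <= _); last first.
  rewrite lerD2l (bigD1 i)//= lerDl; apply: sumr_ge0 => j _; exact: sqrtr_ge0.
have Hx := rkhs_ksec Xx; have Hc := rkhs_ksec (Xc i).
have cs : `|k (c i) x| <= Num.sqrt (k x x) * Num.sqrt (k (c i) (c i)).
  have := rkhs_cauchy_schwarz Hc Hx.
  by rewrite ip_ksec// /rkhs_norm !ip_ksec// mulrC.
have kx0 : 0 <= k x x by rewrite -ip_ksec//; exact: ip_ge0.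
have kc0 : 0 <= k (c i) (c i) by rewrite -ip_ksec//; exact: ip_ge0.
have E1 := sqr_sqrtr kx0; have E2 := sqr_sqrtr kc0.
have s10 := sqrtr_ge0 (k x x); have s20 := sqrtr_ge0 (k (c i) (c i)).
(* Otherwise the norms of the two sections differ by more than 1, against the bound 1 on their
   distance. *)
have [//|hlt] := leP (Num.sqrt (k x x)) (1 + Num.sqrt (k (c i) (c i))).
have := h; rewrite -[leRHS]sqrtr1 ler_sqrt// => h1.
move: cs; rewrite ler_norml => /andP[_ cs]; nra.
Qed.

(** Step functions on ever finer kernel partitions converge uniformly to [f], with error at most its
    norm times the kernel radius of the cells. Off [X] both sides vanish. *)
Lemma rkhs_measurable f : H f -> measurable_fun setT (f : Rd R d -> R).
Proof.
move=> Hf.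
have step (n : nat) : exists g : Rd R d -> R, measurable_fun setT g /\
    forall x, `|f x - g x| <= rkhs_norm f * n.+1%:R^-1.
  have n0 : 0 < (n.+1%:R^-1 : R) by rewrite invr_gt0.
  have [N [c [A [mA dA Xc covX oscA]]]] := kernel_partition n0.
  exists (fun x => \sum_(i < N) f (c i) * \1_(A i) x); split.
    apply: (proj1 (@bounded_mfun_sum R _ (Rd R d) 'I_N (fun i x => f (c i) * \1_(A i) x) _)).
    by move=> i; exact/bounded_mfunZ/bounded_mfun_indic.
  move=> x; have [Xx|nXx] := pselect (X x).
    have [i Aix] := covX _ Xx; rewrite (bigD1 i)//= big1 ?addr0; last first.
      move=> j ji; rewrite indicE memNset ?mulr0// => Ajx.
      by have : (A j `&` A i) x by []; rewrite dA.
    rewrite indicE mem_set// mulr1.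
    apply: le_trans (rkhs_eval_sub_le Hf Xx (Xc i)) _.
    by rewrite ler_wpM2l ?rkhs_norm_ge0//; have [] := oscA _ _ Aix.
  rewrite (rkhs_off Hf nXx) big1 ?subrr ?normr0 ?mulr_ge0 ?rkhs_norm_ge0 ?ltW//.
  move=> i _; rewrite indicE memNset ?mulr0// => Aix.
  by have [] := oscA _ _ Aix.
have [g hg] := choice step.
apply: (@measurable_fun_cvg _ _ _ _ g); first by move=> m; case: (hg m).
move=> x _; apply/cvgrPdist_le => e e0.
have [M hM] : exists M : nat, rkhs_norm f / e <= M%:R.
  by exists (Num.truncn (rkhs_norm f / e)).+1; rewrite ltW// truncnS_gt.
near=> n; apply: le_trans (proj2 (hg n) x) _.
rewrite ler_pdivrMr ?ltr0n// mulrC -ler_pdivrMr//; apply: le_trans hM _.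
by rewrite ler_nat; near: n; exists M => // n /= /leqW.
Unshelve. all: by end_near.
Qed.

Lemma rkhs_bounded_mfun f : H f -> bounded_mfun (f : Rd R d -> R).
Proof.
move=> Hf; split; first exact: rkhs_measurable.
have [K K1 hK] := kernel_bound; exists (rkhs_norm f * K) => x.
have [Xx|nXx] := pselect (X x).
  apply: le_trans (rkhs_eval_le Hf Xx) _.
  by rewrite ler_wpM2l ?rkhs_norm_ge0// hK.
rewrite (rkhs_off Hf nXx) normr0 mulr_ge0 ?rkhs_norm_ge0//; lra.
Qed.

End rkhs.

(** * Density of continuous functions *)

Lemma expect_cvg0 (R : realType) (dT : measure_display) (T : measurableType dT)
    (P : probability T R) (h : nat -> T -> R) (M : R) :
  (forall n, measurable_fun setT (h n)) -> (forall n x, `|h n x| <= M) ->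
  (forall x, h ^~ x @ \oo --> 0) -> (fun n => \int[P]_x h n x) @ \oo --> 0.
Proof.
move=> mh hM h0.
have := @dominated_cvg _ T R P setT measurableT (fun n => EFin \o h n) (fun=> 0%E) (fun=> M%:E).
rewrite integral0 => H.
apply: (@fine_cvg _ _ _ _ _ 0); apply: H => //.
- by move=> n; exact/measurable_EFinP.
- by move=> x _; apply: cvg_EFin; [exact: nearW|exact: h0].
- exact: (bounded_mfun_integrable P (bounded_mfun_cst M)).
- by move=> n x _; rewrite /= lee_fin hM.
Qed.

Lemma bounded_mfun_comp (R : realType) (dT dS : measure_display)
    (T : measurableType dT) (S : measurableType dS) (pi : T -> S) (f : S -> R) :
  measurable_fun setT pi -> bounded_mfun f -> bounded_mfun (fun z => f (pi z)).
Proof.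
move=> mpi [mf [M hM]]; split; first exact: measurableT_comp.
by exists M.
Qed.

(** The sum is the integer part of [t] truncated at [N]. The first clause serves the induction,
    where [t] exceeds the previous bound. *)
Lemma layer_count (R : realType) (t : R) (N : nat) : 0 <= t ->
  (N%:R <= t -> \sum_(j < N) ((j.+1)%:R <= t :> R)%R%:R = N%:R :> R) /\
  (t <= N%:R -> t - 1 <= \sum_(j < N) ((j.+1)%:R <= t :> R)%R%:R <= t).
Proof.
move=> t0; elim: N => [|N [IH1 IH2]].
  by rewrite big_ord0; split=> // tle; apply/andP; split; lra.
rewrite big_ord_recr/=; split.
  move=> h; rewrite h IH1; first by rewrite -natr1.
  by apply: le_trans h; rewrite ler_nat.
rewrite -natr1 => h; have [tN|Nt] := leP t N%:R.
  have /andP[h1 h2] := IH2 tN.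
  have -> : (N%:R + 1 <= t) = false by apply/negP => h3; lra.
  by rewrite addr0 h1.
rewrite (IH1 (ltW Nt)); case: (leP (N%:R + 1) t) => h3 /=; apply/andP; split; lra.
Qed.

(** The average of indicators is [phi] rounded down to a multiple of 1/(N+1), each layer being a
    superlevel set. *)
Lemma layer_cake (R : realType) (dT : measure_display) (T : measurableType dT)
    (phi : T -> R) (N : nat) :
  measurable_fun setT phi -> (forall x, 0 <= phi x <= 1) ->
  exists2 A : 'I_N.+1 -> set T, forall j, measurable (A j) &
    forall x, `|phi x - N.+1%:R^-1 * \sum_j \1_(A j) x| <= N.+1%:R^-1.
Proof.
move=> mphi phi01; exists (fun j => [set x | (j.+1)%:R / N.+1%:R <= phi x]).
  by move=> j; exact: measurable_ge.
move=> x; have /andP[p0 p1] := phi01 x.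
have N0 : 0 < (N.+1%:R : R) by rewrite ltr0n.
have t0 : 0 <= N.+1%:R * phi x by rewrite mulr_ge0// ltW.
have [_ /(_ _)] := layer_count N.+1 t0.
rewrite ger_pMr// p1 => /(_ isT) /andP[h1 h2].
rewrite (eq_bigr (fun j : 'I_N.+1 => ((j.+1)%:R <= N.+1%:R * phi x :> R)%R%:R)); last first.
  move=> j _; rewrite indicE; congr ((_ : bool)%:R).
  by apply/idP/idP; rewrite inE/= ler_pdivrMr// mulrC.
set S := \sum_j _ in h1 h2 *.
have -> : phi x - N.+1%:R^-1 * S = N.+1%:R^-1 * (N.+1%:R * phi x - S).
  by rewrite mulrBr mulKf// gt_eqF.
rewrite normrM gtr0_norm ?invr_gt0// ler_piMr//.
rewrite ger0_norm; lra.
Qed.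

Lemma max_indicator (R : realType) (v w : R) (a b : bool) :
  0 <= v <= 1 -> 0 <= w <= 1 ->
  `|Num.max v w - (a || b)%:R| <= `|v - a%:R| + `|w - b%:R|.
Proof.
move=> /andP[v0 v1] /andP[w0 w1].
have := ler_norm (v - a%:R); have := ler_norm (w - b%:R).
have := ler_norm (- (v - a%:R)); have := ler_norm (- (w - b%:R)).
rewrite !normrN ler_norml; case: a => /=; case: b => /=; case: (leP v w) => ?;
  move=> *; apply/andP; split; lra.
Qed.

Lemma continuous_scaled_sum (R : realType) (T : topologicalType) (I : finType)
    (c : R) (w : I -> T -> R) :
  (forall j, continuous (w j)) -> continuous (fun x => c * \sum_j w j x).
Proof.
move=> cw x; apply: (@cvgM R T (nbhs x) _ (fun=> c) (fun y => \sum_j w j y) c).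
  exact: cvg_cst.
elim: (index_enum I) => [|j s IH].
  by rewrite (_ : (fun y => _) = fun=> 0) ?big_nil; [exact: cvg_cst|apply/funext => y; rewrite big_nil].
rewrite (_ : (fun y => _) = fun y => w j y + \sum_(i <- s) w i y); last first.
  by apply/funext => y; rewrite big_cons.
rewrite big_cons; apply: (@cvgD R R^o T (nbhs x) _ (w j) (fun y => \sum_(i <- s) w i y)) => //.
exact: cw.
Qed.

Section continuous_density.
Context {R : realType} {d : nat} {dT : measure_display} {T : measurableType dT}.
Variables (P : probability T R) (pi : T -> Rd R d).
Hypothesis mpi : measurable_fun setT pi.
Local Notation V := 'rV[R]_d.

Lemma continuous_measurable_Rd (w : V -> R) : continuous w ->
  measurable_fun setT (w : Rd R d -> R).
Proof.
move=> cw; apply: (measurability _ (RGenOInfty.measurableE R)) => _ [_ [a ->] <-].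
rewrite setTI; apply: open_Rd_measurable.
by have := cw => /continuousP; apply; exact: interval_open.
Qed.

(** Approximation in L^1 of the law of [pi] by continuous functions. It bridges the regression
    function, which is merely measurable, and universality, which speaks of continuous functions
    only. *)
Definition approx_continuous (phi : Rd R d -> R) : Prop :=
  forall e : R, 0 < e -> exists w : V -> R,
    [/\ continuous w, (forall x, 0 <= w x <= 1) &
        \int[P]_z `|w (pi z) - phi (pi z)| <= e].

Let bc (w : V -> R) : continuous w -> (forall x, 0 <= w x <= 1) ->
  bounded_mfun (fun z => w (pi z)).
Proof.
move=> cw w01; apply: (bounded_mfun_comp mpi); split.
  exact: continuous_measurable_Rd.
by exists 1 => x; have /andP[? ?] := w01 x; rewrite ger0_norm.
Qed.

Let bd (w : V -> R) phi : continuous w -> (forall x, 0 <= w x <= 1) ->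
  bounded_mfun phi -> bounded_mfun (fun z => `|w (pi z) - phi (pi z)|).
Proof.
move=> cw w01 bphi; apply/bounded_mfun_norm/bounded_mfunB; first exact: bc.
exact: (bounded_mfun_comp mpi).
Qed.

Lemma approx_continuous_lim (phi : nat -> Rd R d -> R) psi :
  (forall n, bounded_mfun (phi n)) -> bounded_mfun psi ->
  (forall n, approx_continuous (phi n)) ->
  (fun n => \int[P]_z `|phi n (pi z) - psi (pi z)|) @ \oo --> 0 ->
  approx_continuous psi.
Proof.
move=> bphi bpsi aphi /cvgrPdist_lt lim e e0.
have [N _ /(_ N (leqnn _))] := lim (e / 2) ltac:(lra).
rewrite sub0r normrN => hN.
have [w [cw w01 hw]] := aphi N (e / 2) ltac:(lra).
exists w; split=> //.
have b1 := bd cw w01 (bphi N).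
have b2 : bounded_mfun (fun z => `|phi N (pi z) - psi (pi z)|).
  by apply/bounded_mfun_norm/bounded_mfunB; exact: (bounded_mfun_comp mpi).
apply: le_trans (_ : \int[P]_z (`|w (pi z) - phi N (pi z)| + `|phi N (pi z) - psi (pi z)|) <= _).
  apply: expect_le; [exact: bd|exact: bounded_mfunD|].
  by move=> z; rewrite (le_trans _ (ler_normD _ _))// addrA subrK.
rewrite expectD//; have := ler_norm (\int[P]_z `|phi N (pi z) - psi (pi z)|); lra.
Qed.

(** Urysohn functions equal to 0 off [U] and to 1 on the points whose ball of radius 1/(n+1) lies in
    [U] converge pointwise to the indicator of [U]; dominated convergence concludes. *)
Lemma approx_continuous_open (U : set V) : open U ->
  approx_continuous (\1_U : Rd R d -> R).
Proof.
move=> oU.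
have step (n : nat) : exists f : V -> R, [/\ continuous f, forall x, 0 <= f x <= 1,
    forall x, ~ U x -> f x = 0 & forall x, ball x n.+1%:R^-1 `<=` U -> f x = 1].
  pose B := [set x : V | ball x (n.+1%:R^-1 : R) `<=` U].
  have : uniform_separator (~` U) B.
    apply: uniform_separatorW; exists [set xy : V * V | ball xy.1 (n.+1%:R^-1 : R) xy.2].
      by rewrite -entourage_ballE; exists n.+1%:R^-1 => //=; rewrite invr_gt0.
    rewrite -subset0 => -[x y] [[/= nUx By] xy]; apply: nUx; apply: By.
    exact: ball_sym.
  move=> /(@uniform_separatorP _ R)[f [cf f01 f0 f1]]; exists f; split=> //.
  - by move=> x; have /= := f01 (f x); rewrite in_itv/=; apply; exists x.
  - by move=> x nUx; apply: f0; exists x.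
  - by move=> x Bx; apply: f1; exists x.
have [f hf] := choice step.
have cf n : continuous (f n) by case: (hf n).
have f01 n x : 0 <= f n x <= 1 by case: (hf n) => _ + _ _; exact.
have mU := open_Rd_measurable oU.
apply: (@approx_continuous_lim f).
- move=> n; split; first exact: continuous_measurable_Rd.
  by exists 1 => x; have /andP[? ?] := f01 n x; rewrite ger0_norm.
- exact: bounded_mfun_indic.
- move=> n e e0; exists (f n); split=> //.
  under eq_Rintegral do rewrite subrr normr0.
  by rewrite expect_cst ltW.
apply: (@expect_cvg0 _ _ _ _ _ 1).
- by move=> n; have [] := bd (cf n) (f01 n) (bounded_mfun_indic mU).
- move=> n z; rewrite normr_id indicE; have /andP[? ?] := f01 n (pi z).
  by rewrite ler_norml; case: (_ \in _) => /=; apply/andP; split; lra.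
move=> z; have [Ux|nUx] := pselect (U (pi z)); last first.
  rewrite (_ : (fun n => _) = fun=> 0); first exact: cvg_cst.
  by apply/funext => n; case: (hf n) => _ _ -> // _; rewrite indicE memNset// subr0 normr0.
have : nbhs (pi z : V) U by move: oU; rewrite openE; exact.
rewrite -nbhs_ballE => -[e /= e0 eU].
apply: cvg_near_cst; have [M hM] : exists M : nat, e^-1 <= M%:R.
  by exists (Num.truncn e^-1).+1; rewrite ltW// truncnS_gt.
exists M => // n /= Mn; rewrite indicE mem_set//=.
case: (hf n) => _ _ _ ->; first by rewrite subrr normr0.
apply: subset_trans eU; apply: le_ball.
rewrite -(invrK e) lef_pV2 ?posrE ?invr_gt0 ?ltr0n//; apply: le_trans hM _.
by rewrite ler_nat (leq_trans Mn).
Qed.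

Lemma approx_continuous_setC (A : set (Rd R d)) :
  approx_continuous \1_A -> approx_continuous \1_(~` A).
Proof.
move=> aA e e0; have [w [cw w01 hw]] := aA e e0.
exists (fun x => 1 - w x); split.
- by move=> x; apply: (@cvgB R R^o _ (nbhs x) _ (fun=> 1) w 1 (w x)); [exact: cvg_cst|exact: cw].
- by move=> x; have /andP[? ?] := w01 x; apply/andP; split; lra.
- apply: le_trans hw; rewrite le_eqVlt; apply/orP; left; apply/eqP.
  apply: eq_Rintegral => z _; rewrite -normrN; congr `|_|.
  rewrite !indicE; have [Az|nAz] := pselect (A (pi z)).
    rewrite [pi z \in ~` A]memNset; last by move/(_ Az).
    by rewrite [pi z \in A]mem_set//=; lra.
  by rewrite [pi z \in ~` A]mem_set// [pi z \in A]memNset//=; lra.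
Qed.

Lemma approx_continuous_setU (A B : set (Rd R d)) : measurable A -> measurable B ->
  approx_continuous \1_A -> approx_continuous \1_B -> approx_continuous \1_(A `|` B).
Proof.
move=> mA mB aA aB e e0.
have [v [cv v01 hv]] := aA (e / 2) ltac:(lra).
have [w [cw w01 hw]] := aB (e / 2) ltac:(lra).
pose u x := Num.max (v x) (w x).
have cu : continuous u.
  by move=> x; apply: (@continuous_max _ _ v w); [exact: cv|exact: cw].
have u01 x : 0 <= u x <= 1.
  have /andP[? ?] := v01 x; have /andP[? ?] := w01 x.
  by rewrite /u le_max ge_max; apply/andP; split; [apply/orP; left|apply/andP].
exists u; split=> //.
have b1 := bd cv v01 (bounded_mfun_indic mA).
have b2 := bd cw w01 (bounded_mfun_indic mB).
apply: le_trans (_ : \int[P]_z (`|v (pi z) - \1_A (pi z)| + `|w (pi z) - \1_B (pi z)|) <= _).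
  apply: expect_le; [|exact: bounded_mfunD|].
    by apply: bd => //; apply: bounded_mfun_indic; exact: measurableU.
  by move=> z; rewrite !indicE in_setU; exact: max_indicator.
rewrite expectD//; lra.
Qed.

(** The approximable measurable sets contain the open sets and are stable under complement and
    countable union, the latter through finite unions and a limit, so they exhaust the Borel
    sets. *)
Lemma approx_continuous_indic (A : set (Rd R d)) : measurable A ->
  approx_continuous \1_A.
Proof.
move=> mA; suff : measurable A /\ approx_continuous \1_A by case.
move: A mA; apply: smallest_sub; last first.
  by move=> U oU; split; [exact: open_Rd_measurable|exact: approx_continuous_open].
split.
- by split; [exact: measurable0|exact/approx_continuous_open/open0].
- move=> A [mA aA]; rewrite setTD; split; first exact: measurableC.
  exact: approx_continuous_setC.
move=> F hF; have mF n := (hF n).1; split; first exact: bigcup_measurable.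
pose S n : set (Rd R d) := \big[setU/set0]_(i < n) F i.
have mS n : measurable (S n) by apply: bigsetU_measurable => i _.
apply: (@approx_continuous_lim (fun n => \1_(S n))).
- by move=> n; exact: bounded_mfun_indic.
- by apply: bounded_mfun_indic; exact: bigcup_measurable.
- elim=> [|n IH]; first by rewrite /S big_ord0; exact/approx_continuous_open/open0.
  rewrite /S big_ord_recr/=; apply: approx_continuous_setU => //; first exact: mS.
  by case: (hF n).
apply: (@expect_cvg0 _ _ _ _ _ 1).
- move=> n; have [//] : bounded_mfun (fun z => `|\1_(S n) (pi z) - \1_(\bigcup_k F k) (pi z)| : R).
  apply/bounded_mfun_norm/bounded_mfunB; apply: (bounded_mfun_comp mpi (bounded_mfun_indic _)) => //.
  exact: bigcup_measurable.
- move=> n z; rewrite normr_id !indicE.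
  by case: (_ \in _); case: (_ \in _); rewrite /= ?subrr ?subr0 ?sub0r ?normrN ?normr0 ?normr1.
move=> z; apply: cvg_near_cst.
have [[i _ Fi]|nF] := pselect ((\bigcup_k F k) (pi z)).
  exists i.+1 => // n /= i_n; rewrite !indicE !mem_set ?subrr ?normr0//; first by exists i.
  by rewrite /S -bigcup_mkord; exists i.
near=> n; rewrite !indicE !memNset ?subrr ?normr0//.
by rewrite /S -bigcup_mkord => -[i /= _ Fi]; apply: nF; exists i.
Unshelve. all: by end_near.
Qed.

(** Half of [e] pays for rounding [phi] to layers, the other half is the common error of the
    approximations of the layers, which averaging preserves. *)
Lemma approx_continuous_measurable (phi : Rd R d -> R) :
  measurable_fun setT phi -> (forall x, 0 <= phi x <= 1) -> approx_continuous phi.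
Proof.
move=> mphi phi01.
have step (N : nat) := layer_cake N mphi phi01.
have bphi : bounded_mfun phi.
  by split=> //; exists 1 => x; have /andP[? ?] := phi01 x; rewrite ger0_norm.
move=> e e0; have [N hN] : exists N : nat, 2 / e <= N.+1%:R.
  by exists (Num.truncn (2 / e)); rewrite ltW// truncnS_gt.
have [A mA hA] := step N.
have N0 : 0 < (N.+1%:R : R) by rewrite ltr0n.
have hN' : N.+1%:R^-1 <= e / 2.
  by rewrite -[e / 2]invrK lef_pV2 ?posrE ?invr_gt0 ?divr_gt0// invf_div.
have [w hw] := choice (fun j => approx_continuous_indic (mA j) (e := e / 2) ltac:(lra)).
have bw j : bounded_mfun (fun z => `|w j (pi z) - \1_(A j) (pi z)|).
  by case: (hw j) => cw w01 _; apply: bd => //; exact: bounded_mfun_indic.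
pose u x := N.+1%:R^-1 * \sum_j w j x.
have cu : continuous u.
  by apply: continuous_scaled_sum => j; case: (hw j).
have u01 x : 0 <= u x <= 1.
  rewrite /u mulr_ge0/=; [|by rewrite invr_ge0 ltW|]; last first.
    by apply: sumr_ge0 => j _; case: (hw j) => _ /(_ x) /andP[].
  rewrite ler_pdivrMl// mulr1; apply: le_trans (_ : \sum_(j < N.+1) 1 <= _).
    by apply: ler_sum => j _; case: (hw j) => _ /(_ x) /andP[].
  by rewrite sumr_const card_ord.
exists u; split=> //.
apply: le_trans (_ : \int[P]_z (N.+1%:R^-1 + N.+1%:R^-1 * \sum_j `|w j (pi z) - \1_(A j) (pi z)|) <= _).
  apply: expect_le; first exact: bd.
    apply: bounded_mfunD; first exact: bounded_mfun_cst.
    by apply: bounded_mfunZ; exact: bounded_mfun_sum.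
  move=> z; rewrite /u.
  rewrite [X in `|X|](_ : _ = - (phi (pi z) - N.+1%:R^-1 * \sum_j \1_(A j) (pi z)) +
      N.+1%:R^-1 * \sum_j (w j (pi z) - \1_(A j) (pi z))); last first.
    by rewrite sumrB; ring.
  apply: le_trans (ler_normD _ _) _; apply: lerD; first by rewrite normrN; exact: hA.
  rewrite normrM gtr0_norm ?invr_gt0// ler_pM2l ?invr_gt0//.
  exact: ler_norm_sum.
rewrite expectD; [|exact: bounded_mfun_cst|by apply: bounded_mfunZ; exact: bounded_mfun_sum].
rewrite expect_cst expectZ; last exact: bounded_mfun_sum.
rewrite expect_sum//.
apply: le_trans (_ : e / 2 + N.+1%:R^-1 * \sum_(j < N.+1) (e / 2) <= _).
  rewrite lerD// ler_pM2l ?invr_gt0//; apply: ler_sum => j _.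
  by case: (hw j).
rewrite sumr_const card_ord -[(e / 2) *+ _]mulr_natl mulKf ?gt_eqF//; lra.
Qed.

End continuous_density.

(** * The population logistic risk *)

Lemma measurable_ln_comp (R : realType) (dT : measure_display)
    (T : measurableType dT) (g : T -> R) :
  measurable_fun setT g -> measurable_fun setT (fun x => ln (g x)).
Proof. by move=> mg; apply: (measurableT_comp (f := @ln R) _ mg); exact: measurable_ln. Qed.

Lemma measurable_expR_comp (R : realType) (dT : measure_display)
    (T : measurableType dT) (g : T -> R) :
  measurable_fun setT g -> measurable_fun setT (fun x => expR (g x)).
Proof. by move=> mg; apply: (measurableT_comp (f := @expR R) _ mg); exact: measurable_expR. Qed.

Section regression.
Context {R : realType} {d : nat}.
Variables (P : probability (Rd R d * bool)%type R) (eta : Rd R d -> R).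
Hypotheses (meta : measurable_fun setT eta) (eta01 : forall x, 0 <= eta x <= 1).
Hypothesis etaP : forall A : set (Rd R d), measurable A ->
  P (A `*` [set true]) = (\int[P]_(z in A `*` setT) (eta z.1)%:E)%E.
Local Notation Z := (Rd R d * bool)%type.
Implicit Types (phi psi : Rd R d -> R).

Lemma measurable_label_true : measurable (setT `*` [set true] : set Z).
Proof. by apply: measurableX => //. Qed.

Lemma bounded_mfun_fst phi : bounded_mfun phi -> bounded_mfun (fun z : Z => phi z.1).
Proof. exact: (bounded_mfun_comp measurable_fst). Qed.

Lemma label_indicE (z : Z) : \1_(setT `*` [set true]) z = (if z.2 then 1 else 0) :> R.
Proof.
rewrite indicE; case: z => x [] /=; first by rewrite mem_set.
by rewrite memNset// => -[].
Qed.

Lemma bounded_mfun_label (F : bool -> Rd R d -> R) :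
  (forall y, bounded_mfun (F y)) -> bounded_mfun (fun z : Z => F z.2 z.1).
Proof.
move=> bF.
have -> : (fun z : Z => F z.2 z.1) = (fun z => F false z.1 +
    \1_(setT `*` [set true]) z * (F true z.1 - F false z.1)).
  apply/funext => -[x y]; rewrite label_indicE /=.
  by case: y; rewrite ?mul1r ?mul0r ?addr0// addrC subrK.
apply: bounded_mfunD; first exact: bounded_mfun_fst.
apply: bounded_mfunM; first exact: (bounded_mfun_indic measurable_label_true).
by apply: bounded_mfunB; exact: bounded_mfun_fst.
Qed.

Let beta : bounded_mfun eta.
Proof. by split=> //; exists 1 => x; have /andP[? ?] := eta01 x; rewrite ger0_norm. Qed.

Let byind : bounded_mfun (fun z : Z => (if z.2 then 1 else 0) : R).
Proof.
by apply: (bounded_mfun_label (F := fun y _ => if y then 1 else 0)) => -[];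
  exact: bounded_mfun_cst.
Qed.

Lemma expect_label_indic (A : set (Rd R d)) : measurable A ->
  \int[P]_z (\1_A z.1 * (if z.2 then 1 else 0)) = \int[P]_z (\1_A z.1 * eta z.1).
Proof.
move=> mA.
have -> : (fun z : Z => \1_A z.1 * (if z.2 then 1 else 0) : R) = \1_(A `*` [set true]).
  apply/funext => -[x y]; rewrite -(label_indicE (x, y)) /= !indicE.
  rewrite -natrM mulnb; congr ((_ : bool)%:R).
  by apply/andP/idP; rewrite !inE/=; [case=> ? [_ ?]|case].
rewrite expect_indic; last exact: measurableX.
rewrite etaP// /Rintegral [in LHS]integral_mkcond; congr fine.
apply: eq_integral => -[x y] _; rewrite patchE/= indicE.
have [Ax|nAx] := pselect (A x); first by rewrite !mem_set ?mul1r.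
by rewrite !memNset ?mul0r//= => -[].
Qed.

(** The defining property of [eta], passed from indicators to functions with values in [0,1] by
    layers, with error at most 1/(N+1) because the label and [eta] differ by at most 1, and then to
    all bounded functions by an affine change. *)
Lemma expect_label phi : bounded_mfun phi ->
  \int[P]_z (phi z.1 * (if z.2 then 1 else 0)) = \int[P]_z (phi z.1 * eta z.1).
Proof.
have base psi : bounded_mfun psi -> (forall x, 0 <= psi x <= 1) ->
    \int[P]_z (psi z.1 * ((if z.2 then 1 else 0) - eta z.1)) = 0.
  move=> bpsi psi01; have [mpsi _] := bpsi.
  have bdiff : bounded_mfun (fun z : Z => (if z.2 then 1 else 0) - eta z.1).
    by apply: bounded_mfunB => //; exact: bounded_mfun_fst.
  have key (N : nat) : `|\int[P]_z (psi z.1 * ((if z.2 then 1 else 0) - eta z.1))| <= N.+1%:R^-1.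
    have [A mA hA] := layer_cake N mpsi psi01.
    have bA j : bounded_mfun (fun z : Z => \1_(A j) z.1 * ((if z.2 then 1 else 0) - eta z.1)).
      by apply: bounded_mfunM => //; exact/bounded_mfun_fst/bounded_mfun_indic.
    have E0 : \int[P]_z (N.+1%:R^-1 * \sum_j \1_(A j) z.1 * ((if z.2 then 1 else 0) - eta z.1)) = 0.
      rewrite expectZ; last exact: bounded_mfun_sum.
      rewrite expect_sum// big1 ?mulr0// => j _.
      have -> : (fun z : Z => \1_(A j) z.1 * ((if z.2 then 1 else 0) - eta z.1)) =
          fun z => \1_(A j) z.1 * (if z.2 then 1 else 0) - \1_(A j) z.1 * eta z.1.
        by apply/funext => z; rewrite mulrBr.
      rewrite expectB ?expect_label_indic ?subrr//; apply: bounded_mfunM => //;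
        do ?exact/bounded_mfun_fst/bounded_mfun_indic; exact: bounded_mfun_fst.
    have -> : \int[P]_z (psi z.1 * ((if z.2 then 1 else 0) - eta z.1)) =
        \int[P]_z (psi z.1 * ((if z.2 then 1 else 0) - eta z.1)) -
        \int[P]_z (N.+1%:R^-1 * \sum_j \1_(A j) z.1 * ((if z.2 then 1 else 0) - eta z.1)).
      by rewrite E0 subr0.
    rewrite -expectB; first last.
    - by apply: bounded_mfunZ; exact: bounded_mfun_sum.
    - by apply: bounded_mfunM => //; exact: bounded_mfun_fst.
    have bB : bounded_mfun (fun z : Z => psi z.1 * ((if z.2 then 1 else 0) - eta z.1) -
       N.+1%:R^-1 * \sum_j \1_(A j) z.1 * ((if z.2 then 1 else 0) - eta z.1)).
      apply: bounded_mfunB; first by apply: bounded_mfunM => //; exact: bounded_mfun_fst.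
      by apply: bounded_mfunZ; exact: bounded_mfun_sum.
    apply: le_trans (expect_norm_le P bB) _.
    rewrite -[leRHS](expect_cst P); apply: expect_le; [exact: bounded_mfun_norm|exact: bounded_mfun_cst|].
    move=> z; rewrite -mulr_suml mulrA -mulrBl normrM.
    apply: le_trans (hA z.1); rewrite ler_piMr//.
    by have /andP[? ?] := eta01 z.1; rewrite ler_norml; case: z.2; apply/andP; split; lra.
  apply/eqP; rewrite -normr_le0; apply/ler_addgt0Pr => e e0; rewrite add0r.
  have [N hN] : exists N : nat, e^-1 <= N.+1%:R.
    by exists (Num.truncn e^-1); rewrite ltW// truncnS_gt.
  by apply: le_trans (key N) _; rewrite -(invrK e) lef_pV2 ?posrE ?invr_gt0.
move=> bphi; have [_ [M0 hM0]] := bphi.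
pose M : R := `|M0| + 1; have Mp : 0 < M by rewrite /M ltr_wpDl.
have hM x : `|phi x| <= M by apply: le_trans (hM0 x) _; rewrite /M (le_trans (ler_norm _))// lerDl.
(* This affine map carries [-M, M] onto [0, 1]. *)
have bpsi : bounded_mfun (fun x => (2 * M)^-1 * (phi x + M)).
  by apply: bounded_mfunZ; apply: bounded_mfunD => //; exact: bounded_mfun_cst.
have h1 := base _ bpsi _; have h0 := base (fun=> 1) (bounded_mfun_cst 1) _.
have b1 : bounded_mfun (fun z : Z => phi z.1 * (if z.2 then 1 else 0)).
  by apply: bounded_mfunM => //; exact: bounded_mfun_fst.
have b2 : bounded_mfun (fun z : Z => phi z.1 * eta z.1).
  by apply: bounded_mfunM; exact: bounded_mfun_fst.
have b3 : bounded_mfun (fun z : Z => 1 * ((if z.2 then 1 else 0) - eta z.1)).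
  by apply: bounded_mfunZ; apply: bounded_mfunB => //; exact: bounded_mfun_fst.
apply/eqP; rewrite -subr_eq0 -expectB//.
have -> : (fun z : Z => phi z.1 * (if z.2 then 1 else 0) - phi z.1 * eta z.1) =
   fun z => (2 * M) * ((2 * M)^-1 * (phi z.1 + M) * ((if z.2 then 1 else 0) - eta z.1))
            - M * (1 * ((if z.2 then 1 else 0) - eta z.1)).
  by apply/funext => z; set b := (if _ then _ else _); field; rewrite gt_eqF.
have b4 : bounded_mfun (fun z : Z => (2 * M)^-1 * (phi z.1 + M) * ((if z.2 then 1 else 0) - eta z.1)).
  apply: bounded_mfunM; first exact: (bounded_mfun_fst bpsi).
  by apply: bounded_mfunB => //; exact: bounded_mfun_fst.
rewrite expectB; [|exact: bounded_mfunZ|exact: bounded_mfunZ].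
rewrite (expectZ P (2 * M) b4) (expectZ P M b3) h0; last by move=> x; rewrite ler01 lexx.
rewrite h1 ?mulr0 ?subrr// => x.
clear h0 h1; have := hM x; rewrite ler_norml => /andP[? ?].
have M2 : 0 < 2 * M by rewrite mulr_gt0.
by rewrite ler_pdivlMl// ler_pdivrMl// mulr0 mulr1; apply/andP; split; lra.
Qed.

Lemma expect_labelE (F : bool -> Rd R d -> R) : (forall y, bounded_mfun (F y)) ->
  \int[P]_z F z.2 z.1 =
  \int[P]_z (eta z.1 * F true z.1 + (1 - eta z.1) * F false z.1).
Proof.
move=> bF; have bD : bounded_mfun (fun x => F true x - F false x) by exact: bounded_mfunB.
have -> : (fun z : Z => F z.2 z.1) = (fun z => F false z.1 +
    (F true z.1 - F false z.1) * (if z.2 then 1 else 0)).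
  by apply/funext => -[x []] /=; rewrite ?mulr1 ?mulr0 ?addr0// addrC subrK.
rewrite expectD; first last.
- apply: bounded_mfunM; last exact: byind.
  exact: (bounded_mfun_fst bD).
- exact: bounded_mfun_fst.
rewrite (expect_label bD) -expectD; first last.
- by apply: bounded_mfunM; [exact: (bounded_mfun_fst bD)|exact: bounded_mfun_fst].
- exact: bounded_mfun_fst.
by apply: eq_Rintegral => z _; ring.
Qed.

Definition logistic_risk (f : Rd R d -> R) : R := \int[P]_z logistic_loss z.2 (f z.1).

(** The conditional entropy of the label, which is the infimum of [logistic_risk] over bounded
    measurable functions by [risk_excess_lower] and [continuous_near_optimal]. *)
Definition bayes_entropy : R := \int[P]_z binary_entropy (eta z.1).

Lemma bounded_mfun_loss y (f : Rd R d -> R) : bounded_mfun f ->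
  bounded_mfun (fun x : Rd R d => logistic_loss y (f x)).
Proof.
move=> [mf [M hM]]; split.
  apply: measurable_ln_comp; apply: measurable_funD; first exact: measurable_cst.
  apply: measurable_expR_comp; apply: measurable_funN.
  by apply: measurable_funM.
exists (1 + M) => x; rewrite ger0_norm ?logistic_loss_ge0//.
by apply: le_trans (logistic_loss_le _ _) _; rewrite lerD2l.
Qed.

Lemma measurable_sigmoid (f : Rd R d -> R) : measurable_fun setT f ->
  measurable_fun setT (fun x => sigmoid (f x)).
Proof.
(* Rewritten so that only exponentials and logarithms have to be measurable. *)
move=> mf; have -> : (fun x => sigmoid (f x)) =
    fun x => expR (- ln (1 + expR (- f x))).
  by apply/funext => x; rewrite ln_sigmoid opprK lnK// posrE sigmoid_gt0.
apply: measurable_expR_comp; apply: measurable_funN.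
apply: measurable_ln_comp; apply: measurable_funD => //.
by apply: measurable_expR_comp; exact: measurable_funN.
Qed.

Lemma bounded_mfun_sigmoid (f : Rd R d -> R) : measurable_fun setT f ->
  bounded_mfun (fun x => sigmoid (f x)).
Proof.
move=> mf; split; first exact: measurable_sigmoid.
by exists 1 => x; rewrite ger0_norm ltW ?sigmoid_gt0 ?sigmoid_lt1.
Qed.

Lemma bounded_mfun_entropy : bounded_mfun (fun x => binary_entropy (eta x)).
Proof.
split.
  rewrite /binary_entropy; apply: measurable_funB.
    apply: measurable_funN; apply: measurable_funM => //.
    exact: measurable_ln_comp.
  apply: measurable_funM; first exact: measurable_funB.
  by apply: measurable_ln_comp; exact: measurable_funB.
(* The entropy is ln 2 minus the excess loss of the zero predictor, and that excess lies in
   [0, 1]. *)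
exists 2 => x; have h1 := excess_loss_lower 0 (eta01 x).
have h2 := excess_loss_upper 0 (eta01 x).
have /andP[e0 e1] := eta01 x.
have l2 := @logistic_loss_le R true 0; have l0 := @logistic_loss_ge0 R true 0.
have s2 : sigmoid (0 : R) = 2^-1 by rewrite /sigmoid oppr0 expR0 div1r.
move: h1 h2 l0 l2; rewrite s2 !logistic_loss0 normr0 => h1 h2 l0 l2.
have h3 : (2^-1 - eta x) ^+ 2 / (2^-1 * (1 - 2^-1)) <= 1.
  rewrite ler_pdivrMr; [nra|lra].
have h4 : 0 <= (2^-1 - eta x) ^+ 2 / 4 by rewrite divr_ge0// sqr_ge0.
by rewrite ler_norml; apply/andP; split; lra.
Qed.

Lemma bounded_mfun_sqdiff (f : Rd R d -> R) : measurable_fun setT f ->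
  bounded_mfun (fun z : Z => (sigmoid (f z.1) - eta z.1) ^+ 2).
Proof.
move=> mf; have h : bounded_mfun (fun x => sigmoid (f x) - eta x).
  by apply: bounded_mfunB => //; exact: bounded_mfun_sigmoid.
by have := bounded_mfun_fst (bounded_mfunM h h).
Qed.

Lemma risk_excessE (f : Rd R d -> R) : bounded_mfun f -> logistic_risk f - bayes_entropy =
  \int[P]_z (eta z.1 * logistic_loss true (f z.1) +
     (1 - eta z.1) * logistic_loss false (f z.1) - binary_entropy (eta z.1)).
Proof.
move=> bf; rewrite /logistic_risk.
rewrite (@expect_labelE (fun y x => logistic_loss y (f x))); last by move=> y; exact: bounded_mfun_loss.
rewrite -expectB//; last exact: (bounded_mfun_fst bounded_mfun_entropy).
apply: bounded_mfunD; apply: bounded_mfunM.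
- exact: bounded_mfun_fst.
- exact: (bounded_mfun_fst (bounded_mfun_loss true bf)).
- by apply: bounded_mfunB; [exact: bounded_mfun_cst|exact: bounded_mfun_fst].
- exact: (bounded_mfun_fst (bounded_mfun_loss false bf)).
Qed.

Let bexcess (f : Rd R d -> R) : bounded_mfun f -> bounded_mfun (fun z : Z =>
  eta z.1 * logistic_loss true (f z.1) +
     (1 - eta z.1) * logistic_loss false (f z.1) - binary_entropy (eta z.1)).
Proof.
move=> bf; apply: bounded_mfunB; last exact: (bounded_mfun_fst bounded_mfun_entropy).
apply: bounded_mfunD; apply: bounded_mfunM.
- exact: bounded_mfun_fst.
- exact: (bounded_mfun_fst (bounded_mfun_loss true bf)).
- by apply: bounded_mfunB; [exact: bounded_mfun_cst|exact: bounded_mfun_fst].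
- exact: (bounded_mfun_fst (bounded_mfun_loss false bf)).
Qed.

Lemma risk_excess_lower (f : Rd R d -> R) : bounded_mfun f ->
  \int[P]_z (sigmoid (f z.1) - eta z.1) ^+ 2 <= 4 * (logistic_risk f - bayes_entropy).
Proof.
move=> bf; have [mf _] := bf; rewrite risk_excessE// -expectZ; last exact: bexcess.
apply: expect_le; [exact: bounded_mfun_sqdiff|by apply: bounded_mfunZ; exact: bexcess|].
by move=> z; have := excess_loss_lower (f z.1) (eta01 z.1); lra.
Qed.

(** A continuous L^1 approximation [w] of [eta] is squeezed into [ka, 1 - ka] and passed through the
    logit. The squeeze keeps the logit bounded and the chi-square denominator away from 0. *)
Lemma continuous_near_optimal (e : R) : 0 < e ->
  exists u : 'rV[R]_d -> R, [/\ continuous u, bounded_mfun (u : Rd R d -> R) &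
    logistic_risk u <= bayes_entropy + e].
Proof.
move=> e0.
(* The final bound is [4 * ka] plus [4 / ka] times the L^1 error of [w]; [ka <= e / 8] and an error
   of [ka * e / 8] make each term at most [e / 2]. *)
pose ka := Num.min (e / 8) (4^-1 : R).
have ka0 : 0 < ka by rewrite /ka lt_min; apply/andP; split; lra.
have ka4 : ka <= 4^-1 by rewrite /ka ge_min lexx orbT.
have kae : ka <= e / 8 by rewrite /ka ge_min lexx.
have [w [cw w01 hw]] := @approx_continuous_measurable _ _ _ _ P fst measurable_fst eta meta eta01
  (ka * e / 8) ltac:(by rewrite divr_gt0 ?mulr_gt0).
pose s x := ka + (1 - 2 * ka) * w x.
have sl x : ka <= s x by have /andP[? ?] := w01 x; rewrite /s; nra.
have su x : s x <= 1 - ka by have /andP[? ?] := w01 x; rewrite /s; nra.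
have s01 x : 0 < s x < 1 by have := sl x; have := su x => *; apply/andP; split; lra.
have q0 x : 0 < s x / (1 - s x) by have /andP[? ?] := s01 x; rewrite divr_gt0//; lra.
pose u x := ln (s x / (1 - s x)).
have cs : continuous s.
  move=> x; apply: (@cvgD R R^o _ (nbhs x) _ (fun=> ka) (fun y => (1 - 2 * ka) * w y)); first exact: cvg_cst.
  by apply: (@cvgM R _ (nbhs x) _ (fun=> _) w); [exact: cvg_cst|exact: cw].
have cu : continuous u.
  move=> x; apply: (@continuous_comp _ _ _ (fun y => s y / (1 - s y)) (@ln R)); last exact: continuous_ln.
  apply: (@cvgM R _ (nbhs x) _ s (fun y => (1 - s y)^-1)); first exact: cs.
  apply: cvgV; first by have /andP[? ?] := s01 x; rewrite gt_eqF//; lra.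
  by apply: (@cvgB R R^o _ (nbhs x) _ (fun=> 1) s); [exact: cvg_cst|exact: cs].
have bu : bounded_mfun (u : Rd R d -> R).
  split; first exact: continuous_measurable_Rd.
  exists (ln (ka^-1)) => x; have /andP[? ?] := s01 x.
  rewrite /u ler_norml -lnV ?posrE ?invr_gt0// invrK !ler_ln ?posrE ?invr_gt0//.
  have := sl x; have := su x => h1 h2.
  apply/andP; split; first by rewrite ler_pdivlMr; [nra|lra].
  rewrite ler_pdivrMr; last lra.
  by rewrite -ler_pdivrMl ?invr_gt0// invrK; nra.
exists u; split=> //; rewrite -lerBlDl risk_excessE//.
apply: le_trans (_ : \int[P]_z (4 * ka + 4 / ka * `|w z.1 - eta z.1|) <= _).
  have bwe : bounded_mfun (fun z : Z => `|w z.1 - eta z.1|).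
    apply/bounded_mfun_norm/bounded_mfunB; last exact: bounded_mfun_fst.
    apply: bounded_mfun_fst; split; first exact: continuous_measurable_Rd.
    by exists 1 => x; have /andP[? ?] := w01 x; rewrite ger0_norm.
  apply: expect_le; first exact: bexcess.
    by apply: bounded_mfunD; [exact: bounded_mfun_cst|exact: bounded_mfunZ].
  move=> z; apply: le_trans (excess_loss_upper (u z.1) (eta01 z.1)) _.
  rewrite /u sigmoid_logit//.
  have h1 := sl z.1; have h2 := su z.1.
  have /andP[w0 w1] := w01 z.1; have /andP[t0 t1] := eta01 z.1.
  have hs : ka / 2 <= s z.1 * (1 - s z.1) by nra.
  have hs0 : 0 < s z.1 * (1 - s z.1) by lra.
  rewrite ler_pdivrMr//.
  set a := `|w z.1 - eta z.1|.
  have a0 : 0 <= a := normr_ge0 _.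
  have a1 : a <= 1 by rewrite /a ler_norml; apply/andP; split; lra.
  have ha : (s z.1 - eta z.1) ^+ 2 <= 2 * ka ^+ 2 + 2 * a.
    have ha2 : a ^+ 2 = (w z.1 - eta z.1) ^+ 2 by rewrite /a real_normK// num_real.
    have hv : (ka - 2 * ka * w z.1) ^+ 2 <= ka ^+ 2.
      rewrite -subr_ge0 (_ : _ - _ = 4 * (ka ^+ 2 * (w z.1 * (1 - w z.1)))); last by ring.
      apply: mulr_ge0 => //; apply: mulr_ge0; first exact: sqr_ge0.
      by apply: mulr_ge0 => //; lra.
    have hE : s z.1 - eta z.1 = (ka - 2 * ka * w z.1) + (w z.1 - eta z.1) by rewrite /s; ring.
    have aa : a ^+ 2 <= a by rewrite expr2 ler_piMr.
    rewrite hE; move: hv ha2; set p := ka - _; set q := _ - eta _ => hv ha2.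
    have := sqr_ge0 (p - q); nra.
  apply: le_trans ha _.
  have c0 : 0 <= 4 * ka + 4 / ka * a.
    by rewrite addr_ge0 ?mulr_ge0 ?invr_ge0// ltW.
  apply: le_trans (ler_wpM2l c0 hs).
  rewrite le_eqVlt; apply/orP; left; apply/eqP; field; rewrite gt_eqF//.
have bwe : bounded_mfun (fun z : Z => `|w z.1 - eta z.1|).
  apply/bounded_mfun_norm/bounded_mfunB; last exact: bounded_mfun_fst.
  apply: bounded_mfun_fst; split; first exact: continuous_measurable_Rd.
  by exists 1 => x; have /andP[? ?] := w01 x; rewrite ger0_norm.
rewrite expectD; [|exact: bounded_mfun_cst|exact: bounded_mfunZ].
rewrite expect_cst expectZ//.
have h4 : 4 / ka * (\int[P]_z `|w z.1 - eta z.1|) <= 4 / ka * (ka * e / 8).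
  by rewrite ler_wpM2l// divr_ge0// ltW.
have h5 : 4 / ka * (ka * e / 8) = e / 2 by field; rewrite gt_eqF.
lra.
Qed.

End regression.

(** * Stability of kernel logistic regression *)

Section kernel_expansions.
Context {R : realType} {d : nat}.
Local Notation V := 'rV[R]_d.
Variables (X : set V) (k : V -> V -> R) (H : set (V -> R)).
Variable ip : (V -> R) -> (V -> R) -> R.
Hypothesis rkhsH : is_RKHS X k H ip.
Variables (I : finType) (p : I -> V).
Hypothesis Xp : forall i, X (p i).

Definition kernel_comb (b : I -> R) : V -> R :=
  fun x => \sum_i b i * ksec X k (p i) x.

(** By the reproducing property, pairing with a kernel combination is a weighted sum of point
    evaluations, which turns empirical averages into inner products. *)
Lemma ip_kernel_comb b : H (kernel_comb b) /\
  forall h, H h -> ip h (kernel_comb b) = \sum_i b i * h (p i).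
Proof.
rewrite /kernel_comb; elim: (index_enum I) => [|i s [IH1 IH2]].
  under eq_fun do rewrite big_nil.
  split=> [|h Hh]; first exact: (rkhs0 rkhsH).
  rewrite big_nil; have := ipZr rkhsH 0 (rkhs0 rkhsH) Hh.
  by under eq_fun do rewrite mul0r; rewrite mul0r.
under eq_fun do rewrite big_cons.
have Hi := rkhsZ rkhsH (b i) (rkhs_ksec rkhsH (Xp i)).
split=> [|h Hh]; first exact: (rkhsD rkhsH).
rewrite (ipDr rkhsH)// big_cons IH2// (ipZr rkhsH)//; last exact: (rkhs_ksec rkhsH).
by rewrite -(reproducing rkhsH).
Qed.

Lemma norm_kernel_comb b :
  ip (kernel_comb b) (kernel_comb b) = \sum_i \sum_j b i * b j * k (p i) (p j).
Proof.
have [Hv ipv] := ip_kernel_comb b; rewrite ipv//; apply: eq_bigr => i _.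
rewrite /kernel_comb mulr_sumr; apply: eq_bigr => j _.
have Hi := rkhs_ksec rkhsH (Xp i); have Hj := rkhs_ksec rkhsH (Xp j).
rewrite mulrA; congr (_ * _).
by rewrite (reproducing rkhsH Hj)// (ipC rkhsH)// (ip_ksec rkhsH).
Qed.

End kernel_expansions.

Section klr.
Context {R : realType} {d : nat}.
Local Notation V := 'rV[R]_d.
Local Notation Z := (Rd R d * bool)%type.
Variables (X : set V) (k : V -> V -> R) (H : set (V -> R)).
Variable ip : (V -> R) -> (V -> R) -> R.
Hypotheses (kpd : pd_kernel X k) (rkhsH : is_RKHS X k H ip) (cX : compact X).
Variable P : probability Z R.
Variable K : R.
Hypotheses (K1 : 1 <= K) (hK : forall x, X x -> Num.sqrt (k x x) <= K).
Implicit Types f g h : V -> R.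
Local Notation nrm := (rkhs_norm ip).

Lemma rkhs_sup_le f x : H f -> `|f x| <= K * nrm f.
Proof.
move=> Hf; have [Xx|nXx] := pselect (X x).
  rewrite mulrC; apply: le_trans (rkhs_eval_le rkhsH Hf Xx) _.
  by rewrite ler_wpM2l ?rkhs_norm_ge0// hK.
rewrite (rkhs_off rkhsH Hf nXx) normr0; apply: mulr_ge0; last exact: rkhs_norm_ge0.
exact: le_trans ler01 K1.
Qed.

Let bH : forall f, H f -> bounded_mfun (f : Rd R d -> R) := rkhs_bounded_mfun kpd rkhsH cX.

Lemma bounded_mfun_risk f : H f -> bounded_mfun (fun z : Z => logistic_loss z.2 (f z.1)).
Proof.
move=> Hf; apply: (@bounded_mfun_label _ _ (fun y (x : Rd R d) => logistic_loss y (f x))) => y.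
by apply: bounded_mfun_loss; exact: bH.
Qed.

Lemma bounded_mfun_grad f : H f -> bounded_mfun (fun z : Z => logistic_grad z.2 (f z.1)).
Proof.
move=> Hf; apply: (@bounded_mfun_label _ _ (fun y (x : Rd R d) => logistic_grad y (f x))) => y.
apply: bounded_mfunB; last exact: bounded_mfun_cst.
by apply: bounded_mfun_sigmoid; case: (bH Hf).
Qed.

Definition reg_risk (lam : R) f : R := lam / 2 * ip f f + logistic_risk P f.

(** The differential of [reg_risk lam] at [g] in direction [h]. It is used only through its values
    on directions, so no representing element of [H] is built. *)
Definition reg_risk_diff (lam : R) g h : R :=
  lam * ip g h + \int[P]_z (logistic_grad z.2 (g z.1) * h z.1).

(** The regularized risk is bounded below by 0, so its infimum is approached within any [tau]. *)
Lemma reg_risk_near_min (lam tau : R) : 0 < lam -> 0 < tau ->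
  exists2 g, H g & forall f, H f -> reg_risk lam g <= reg_risk lam f + tau.
Proof.
move=> lam0 tau0; pose S := [set reg_risk lam f | f in H].
have Slb : lbound S 0.
  move=> _ [f Hf <-]; rewrite /reg_risk addr_ge0//.
    by rewrite mulr_ge0 ?(ip_ge0 rkhsH)// divr_ge0// ltW.
  by apply: Rintegral_ge0 => z _; exact: logistic_loss_ge0.
have hS : has_inf S.
  by split; [exists (reg_risk lam (fun=> 0)); exists (fun=> 0) => //; exact: (rkhs0 rkhsH)|exists 0].
have [_ [g Hg <-] hg] := inf_adherent tau0 hS.
exists g => // f Hf; apply: le_trans (ltW hg) _; rewrite lerD2r.
by apply: ge_inf; [exists 0|exists f].
Qed.

(* An almost-minimizer of a smooth functional has an almost-vanishing
   differential: step from [g] along [h] by [tau / |h|]. *)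
Lemma reg_risk_diff_near_min (lam tau : R) g h : 0 < lam -> 0 < tau ->
  tau * K <= 2^-1 -> H g -> H h ->
  (forall f, H f -> reg_risk lam g <= reg_risk lam f + tau ^+ 2) ->
  - reg_risk_diff lam g h <= tau * (1 + lam / 2 + 2 * K ^+ 2) * nrm h.
Proof.
move=> lam0 tau0 tauK Hg Hh gmin.
have n0 : 0 <= nrm h := rkhs_norm_ge0 _ _.
move: n0; rewrite le0r => /orP[/eqP nh0|n0].
  have h0 := rkhs_norm_eq0 rkhsH Hh nh0.
  rewrite nh0 mulr0 /reg_risk_diff h0.
  have := ipZr rkhsH 0 (rkhs0 rkhsH) Hg; under eq_fun do rewrite mul0r.
  rewrite mul0r => ->; rewrite mulr0 add0r.
  under eq_Rintegral do rewrite mulr0.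
  by rewrite expect_cst oppr0.
set n := nrm h in n0 *; pose s := tau / n; have s0 : 0 < s by rewrite divr_gt0.
have Hsh := rkhsZ rkhsH s Hh; have Hf := rkhsD rkhsH Hg Hsh.
have := gmin _ Hf; rewrite /reg_risk (ip_quad rkhsH)// -(rkhs_norm_sqr rkhsH Hh) -/n.
have sn : s * n = tau by rewrite /s divfK// gt_eqF.
have bg := bounded_mfun_grad Hg; have bh := bounded_mfun_fst (bH Hh).
have bgh := bounded_mfunM bg bh.
(* The step has RKHS norm [tau], so [tauK] keeps it in the range of the quadratic upper bound. *)
have small x : `|s * h x| <= 2^-1.
  rewrite normrM gtr0_norm//; apply: le_trans tauK.
  rewrite -sn -mulrA ler_pM2l// mulrC; exact: rkhs_sup_le.
have hL : logistic_risk P (fun x => g x + s * h x) <= logistic_risk P g +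
    s * \int[P]_z (logistic_grad z.2 (g z.1) * h z.1) + 2 * (s * (K * n)) ^+ 2.
  rewrite -expectZ// -expectD; [|exact: bounded_mfun_risk|exact: bounded_mfunZ].
  rewrite -[2 * _ ^+ 2](expect_cst P) -expectD; [| |exact: bounded_mfun_cst]; last first.
    by apply: bounded_mfunD; [exact: bounded_mfun_risk|exact: bounded_mfunZ].
  apply: expect_le; first exact: (bounded_mfun_risk Hf).
    apply: bounded_mfunD; last exact: bounded_mfun_cst.
    by apply: bounded_mfunD; [exact: bounded_mfun_risk|exact: bounded_mfunZ].
  move=> z; apply: le_trans (logistic_loss_upper z.2 (g z.1) (small z.1)) _.
  rewrite mulrCA lerD2l ler_pM2l// -real_normK ?num_real//.
  have K0 : 0 < K by exact: lt_le_trans ltr01 K1.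
  rewrite ler_pXn2r ?nnegrE//; last first.
    by apply: mulr_ge0; [exact: ltW|apply: mulr_ge0; exact: ltW].
  by rewrite normrM gtr0_norm// ler_pM2l//; exact: rkhs_sup_le.
move=> h1; rewrite /reg_risk_diff.
set D1 := ip g h in h1 *; set D2 := \int[P]_z _ in hL *.
have e1 : 2 * (s * (K * n)) ^+ 2 = 2 * K ^+ 2 * tau ^+ 2 by rewrite -sn; ring.
have e2 : s ^+ 2 * n ^+ 2 = tau ^+ 2 by rewrite -sn; ring.
rewrite e1 in hL; rewrite e2 in h1.
have h2 : - (s * (lam * D1 + D2)) <= tau ^+ 2 * (1 + lam / 2 + 2 * K ^+ 2).
  have aux (a u v t c : R) : lam / 2 * a + u <= lam / 2 * (a + 2 * s * D1 + t) + v + t ->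
    v <= u + s * D2 + 2 * c * t -> - (s * (lam * D1 + D2)) <= t * (1 + lam / 2 + 2 * c).
    by clear; nra.
  exact: aux h1 hL.
have -> : - (lam * D1 + D2) = - (s * (lam * D1 + D2)) * s^-1.
  by field; rewrite gt_eqF.
rewrite ler_pdivrMr//; apply: le_trans h2 _; rewrite le_eqVlt; apply/orP; left; apply/eqP.
by rewrite -sn; ring.
Qed.

(* Strong convexity turns a bound on the empirical gradient at [g], applied
   in the direction [f - g] only, into a bound on [f - g]. *)
Lemma klr_stability (lam zeta : R) (m : nat) (D : nat -> Z) f g :
  0 < lam -> 0 <= zeta -> klr_solution H ip lam m D f -> H g ->
  (forall h, H h -> - (lam * ip g h + m%:R^-1 * \sum_(i < m)
      (logistic_grad (D i).2 (g (D i).1) * h (D i).1)) <= zeta * nrm h) ->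
  nrm (fun x => f x - g x) <= 2 * zeta / lam.
Proof.
move=> lam0 zeta0 [Hf fmin] Hg hz.
have Hh := rkhsB rkhsH Hf Hg; set h := (fun x => f x - g x) in Hh *.
have fE : f = fun x => g x + 1 * h x by apply/funext => x; rewrite mul1r /h addrC subrK.
have := fmin _ Hg; rewrite /klr_obj {1 2}fE (ip_quad rkhsH)// => h1.
have h2 : m%:R^-1 * \sum_(i < m) (logistic_loss (D i).2 (g (D i).1) +
     logistic_grad (D i).2 (g (D i).1) * h (D i).1) <=
   m%:R^-1 * \sum_(i < m) logistic_loss (D i).2 (f (D i).1).
  rewrite ler_wpM2l ?invr_ge0//; apply: ler_sum => i _.
  by apply: le_trans (logistic_loss_tangent _ _ _) _; rewrite /h [g _ + _]addrC subrK.
move: h2; rewrite big_split/= mulrDr => h2.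
have h3 := hz _ Hh.
have n2 := rkhs_norm_sqr rkhsH Hh.
have n0 : 0 <= nrm h := rkhs_norm_ge0 _ _.
rewrite -n2 in h1.
move: h1; rewrite -/(logistic_loss _ _) => h1.
(* Sum of the optimality of [f] against [g], the tangent inequality at the samples, and [hz]. *)
have h4 : lam / 2 * nrm h ^+ 2 <= zeta * nrm h.
  move: h1 h2 h3; rewrite /logistic_loss.
  set a := m%:R^-1 * _; set b := m%:R^-1 * _; set c := m%:R^-1 * _.
  by rewrite !mulrDr; lra.
move: n0; rewrite le0r => /orP[/eqP ->|n0].
  by rewrite divr_ge0 ?mulr_ge0// ltW.
rewrite ler_pdivlMr//.
have E : lam / 2 * nrm h * nrm h = lam / 2 * nrm h ^+ 2 by ring.
have : lam / 2 * nrm h <= zeta by rewrite -(ler_pM2r n0) E.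
lra.
Qed.

Lemma logistic_grad_lip y (a b : R) :
  `|logistic_grad y a - logistic_grad y b| <= `|a - b|.
Proof.
rewrite /logistic_grad [X in `|X|](_ : _ = sigmoid a - sigmoid b); last by ring.
exact: sigmoid_lip.
Qed.

Section concentration.
Context {dO : measure_display} {Omega : measurableType dO}.
Variables (Pr : probability Omega R) (Zs : nat -> Omega -> Z).
Hypothesis iidZ : pairwise_iid Pr Zs P.

(** One event serves all directions [h]. With the integrand frozen on each cell and label, the
    deviation becomes the inner product of [h] with a random kernel combination [v], and the event
    is that [v] has norm at least [r]. The term [rho] pays for the freezing, half under [P] and half
    under the sample. *)
Lemma gradient_concentration (m : nat) (r rho : R) g :
  (0 < m)%N -> 0 < r -> 0 < rho -> H g ->
  exists E : set Omega, [/\ measurable E, fine (Pr E) <= K ^+ 2 / (m%:R * r ^+ 2) &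
    forall w, ~ E w -> forall h, H h ->
      \int[P]_z (logistic_grad z.2 (g z.1) * h z.1) - m%:R^-1 * \sum_(i < m)
        (logistic_grad (Zs i w).2 (g (Zs i w).1) * h (Zs i w).1) <=
      (r + rho) * nrm h].
Proof.
move=> m0 r0 rho0 Hg.
have K0 : 0 < K by exact: lt_le_trans ltr01 K1.
have mr0 : 0 < (m%:R : R) by rewrite ltr0n.
(* On a cell of kernel radius [rho / (2 * B)] the integrand varies by at most [rho / 2] times the
   norm of [h]: [K * nrm g] comes from the gradient at [g], and 1 from [h] itself. *)
pose B := 1 + K * nrm g.
have B0 : 0 < B by rewrite /B ltr_pwDl// mulr_ge0 ?rkhs_norm_ge0// ltW.
have rB : 0 < rho / (2 * B) by rewrite divr_gt0// mulr_gt0.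
have [N [c [A [mA dA Xc covX oscA]]]] := kernel_partition kpd cX rB.
pose I := ('I_N * bool)%type.
pose C (q : I) : set Z := A q.1 `*` [set q.2].
pose a (q : I) := logistic_grad q.2 (g (c q.1)).
have mC q : measurable (C q) by apply: measurableX.
have dC q q' : q != q' -> C q `&` C q' = set0.
  move=> qq'; rewrite -subset0 => -[x y] [[/= Aq ->] [/= Aq' qy]].
  have [q1|q1] := eqVneq q.1 q'.1.
    by move: qq'; rewrite -pair_eqE/= q1 qy !eqxx.
  by have : (A q.1 `&` A q'.1) x by []; rewrite dA.
pose p (q : I) := c q.1.
have Xp q : X (p q) by exact: Xc.
pose wt (q q' : I) := a q * a q' * k (p q) (p q').
have Qip (x : I -> R) : \sum_q \sum_q' x q * x q' * wt q q' =
    ip (kernel_comb X k p (fun q => x q * a q)) (kernel_comb X k p (fun q => x q * a q)).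
  rewrite (norm_kernel_comb rkhsH Xp); apply: eq_bigr => q _; apply: eq_bigr => q' _.
  by rewrite /wt; ring.
have psd (x : I -> R) : 0 <= \sum_q \sum_q' x q * x q' * wt q q'.
  by rewrite Qip; apply: (ip_ge0 rkhsH); have [] := ip_kernel_comb rkhsH Xp (fun q => x q * a q).
have wtK q : wt q q <= K ^+ 2.
  rewrite /wt -expr2; have k0 : 0 <= k (p q) (p q).
    by rewrite -(ip_ksec rkhsH)//; apply: (ip_ge0 rkhsH); exact: (rkhs_ksec rkhsH).
  have kK : k (p q) (p q) <= K ^+ 2.
    by rewrite -(sqr_sqrtr k0) ler_pXn2r ?nnegrE ?sqrtr_ge0 ?hK// ltW.
  have a1 : a q ^+ 2 <= 1.
    by rewrite -real_normK ?num_real// exprn_ile1// logistic_grad_le1.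
  by rewrite -[leRHS]mul1r ler_pM// sqr_ge0.
have r20 : 0 < r ^+ 2 by rewrite exprn_gt0.
exists [set o | r ^+ 2 <= \sum_q \sum_q' freq_dev Zs P m (C q) o * freq_dev Zs P m (C q') o * wt q q'].
split.
- exact: (measurable_freq_quad iidZ).
- by apply: (freq_quad_tail iidZ) => //; exact: sqr_ge0.
move=> w /negP; rewrite -ltNge Qip => Qlt h Hh.
set b := (fun q => _) in Qlt; set v := kernel_comb X k p b in Qlt.
have [Hv ipv] := ip_kernel_comb rkhsH Xp b.
have nv : nrm v <= r.
  by rewrite -(ger0_norm (ltW r0)) -sqrtr_sqr ler_wsqrtr// ltW.
pose G (z : Z) := logistic_grad z.2 (g z.1) * h z.1.
pose S (z : Z) := \sum_q a q * h (p q) * \1_(C q) z.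
have bG : bounded_mfun G.
  by apply: bounded_mfunM; [exact: bounded_mfun_grad|exact: (bounded_mfun_fst (bH Hh))].
have bC q : bounded_mfun (fun z => a q * h (p q) * \1_(C q) z).
  by apply: bounded_mfunZ; exact: bounded_mfun_indic.
have bS : bounded_mfun S by exact: bounded_mfun_sum.
have GS z : `|G z - S z| <= rho / 2 * nrm h.
  case: z => x y; rewrite /G /S /=.
  have [Xx|nXx] := pselect (X x); last first.
    rewrite (rkhs_off rkhsH Hh nXx) mulr0 big1 ?subr0 ?normr0.
      by rewrite mulr_ge0 ?rkhs_norm_ge0// divr_ge0// ltW.
    move=> q _; rewrite indicE memNset ?mulr0// => -[/= Aqx _].
    by have [] := oscA _ _ Aqx.
  have [j Ajx] := covX _ Xx.
  rewrite (bigD1 (j, y))//= big1 ?addr0; last first.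
    move=> q qj; rewrite indicE memNset ?mulr0// => Cqx.
    by have : (C q `&` C (j, y)) (x, y) by []; rewrite dC.
  rewrite indicE mem_set// mulr1 /a /p /=.
  have [_ osc] := oscA _ _ Ajx.
  have hosc f : H f -> `|f x - f (c j)| <= nrm f * (rho / (2 * B)).
    move=> Hf; apply: le_trans (rkhs_eval_sub_le kpd rkhsH Hf Xx (Xc j)) _.
    by rewrite ler_wpM2l ?rkhs_norm_ge0.
  rewrite [X in `|X|](_ : _ = (logistic_grad y (g x) - logistic_grad y (g (c j))) * h x +
     logistic_grad y (g (c j)) * (h x - h (c j))); last by ring.
  apply: le_trans (ler_normD _ _) _; rewrite !normrM.
  have h1 : `|logistic_grad y (g x) - logistic_grad y (g (c j))| * `|h x| <=
      (nrm g * (rho / (2 * B))) * (K * nrm h).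
    rewrite ler_pM//; last exact: rkhs_sup_le.
    exact: le_trans (logistic_grad_lip _ _ _) (hosc _ Hg).
  have h2 : `|logistic_grad y (g (c j))| * `|h x - h (c j)| <= 1 * (nrm h * (rho / (2 * B))).
    by rewrite ler_pM ?logistic_grad_le1 ?hosc.
  apply: le_trans (lerD h1 h2) _.
  rewrite [leLHS](_ : _ = rho / 2 * nrm h)//.
  rewrite (_ : rho / (2 * B) = rho / 2 / B); last by field; rewrite gt_eqF.
  have -> : nrm g * (rho / 2 / B) * (K * nrm h) + 1 * (nrm h * (rho / 2 / B)) =
     rho / 2 * nrm h * (B / B) by rewrite /B; ring.
  by rewrite divff ?mulr1// gt_eqF.
have eG : `|\int[P]_z G z - \int[P]_z S z| <= rho / 2 * nrm h.
  rewrite -expectB//; apply: le_trans (expect_norm_le P (bounded_mfunB bG bS)) _.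
  rewrite -[leRHS](expect_cst P); apply: expect_le => //; last exact: bounded_mfun_cst.
  by apply: bounded_mfun_norm; exact: bounded_mfunB.
have mG : `|m%:R^-1 * \sum_(i < m) S (Zs i w) - m%:R^-1 * \sum_(i < m) G (Zs i w)| <= rho / 2 * nrm h.
  rewrite -mulrBr -sumrB normrM gtr0_norm ?invr_gt0//.
  rewrite ler_pdivrMl//; apply: le_trans (ler_norm_sum _ _ _) _.
  apply: le_trans (_ : \sum_(i < m) (rho / 2 * nrm h) <= _).
    by apply: ler_sum => i _; rewrite distrC.
  by rewrite sumr_const card_ord -[_ *+ m]mulr_natl.
have Sv : m%:R^-1 * \sum_(i < m) S (Zs i w) - \int[P]_z S z = ip h v.
  rewrite ipv// /S expect_sum// exchange_big mulr_sumr -sumrB; apply: eq_bigr => q _.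
  rewrite expectZ; last exact: bounded_mfun_indic.
  rewrite expect_indic// /b /freq_dev sumrB sumr_const card_ord -[fine _ *+ m]mulr_natl.
  rewrite -mulr_sumr; field; exact: lt0r_neq0.
have cs := rkhs_cauchy_schwarz rkhsH Hh Hv.
have hv : `|ip h v| <= r * nrm h.
  by apply: le_trans cs _; rewrite mulrC ler_wpM2r ?rkhs_norm_ge0.
move: eG mG hv; rewrite -Sv !ler_norml => /andP[_ e1] /andP[_ e2] /andP[e3 _].
rewrite -/(G _) mulrDl; move: e1 e2 e3; rewrite /G; lra.
Qed.

(** Three errors enter the empirical gradient at [g]: sampling, discretization, and the inexact
    minimality of [g]. Each receives [r]; stability then gives the norm bound [6 * r / lam]. *)
Lemma klr_concentration (lam delta tau0 : R) (m : nat) (fh : (nat -> Z) -> V -> R) :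
  0 < lam -> (0 < m)%N -> 0 < delta -> 0 < tau0 ->
  (forall D, klr_solution H ip lam m D (fh D)) ->
  exists g, [/\ H g, forall f, H f -> reg_risk lam g <= reg_risk lam f + tau0 &
    exists E : set Omega, [/\ measurable E,
      fine (Pr E) <= 64 * K ^+ 4 / (m%:R * lam ^+ 2 * delta ^+ 2) &
      forall w, ~ E w -> forall x, `|fh (fun i => Zs i w) x - g x| <= delta]].
Proof.
move=> lam0 m0 delta0 tau00 hfh.
have K0 : 0 < K by exact: lt_le_trans ltr01 K1.
pose L := 1 + lam / 2 + 2 * K ^+ 2.
have L0 : 0 < L.
  have : 0 <= 2 * K ^+ 2 by rewrite mulr_ge0// sqr_ge0.
  by rewrite /L; lra.
(* Makes the sup-norm bound [6 * K * r / lam] equal to three quarters of [delta]. *)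
pose r := lam * delta / (8 * K).
have r0 : 0 < r by rewrite /r !(divr_gt0, mulr_gt0).
(* In order: [tau ^+ 2 <= tau], near-minimality within [tau0], admissible step size, and
   differential at most [r]. *)
pose tau := Num.min (Num.min 1 tau0) (Num.min (2^-1 / K) (r / L)).
have tau_gt0 : 0 < tau.
  rewrite /tau !lt_min ltr01 tau00/=.
  by apply/andP; split; rewrite divr_gt0 ?invr_gt0.
have [t1 t2 t3 t4] : [/\ tau <= 1, tau <= tau0, tau <= 2^-1 / K & tau <= r / L].
  by rewrite /tau !ge_min !lexx !orbT.
have tt : tau ^+ 2 <= tau0.
  by apply: le_trans t2; rewrite expr2 ler_piMr// ltW.
have [g Hg gmin] := reg_risk_near_min lam0 (exprn_gt0 2 tau_gt0).
exists g; split=> //.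
  by move=> f Hf; apply: le_trans (gmin f Hf) _; rewrite lerD2l.
have [E [mE PE hE]] := gradient_concentration m0 r0 r0 Hg.
exists E; split=> //.
  apply: le_trans PE _; rewrite le_eqVlt; apply/orP; left; apply/eqP.
  rewrite /r; field.
  by rewrite !gt_eqF// ltr0n.
move=> w nEw x.
have st : rkhs_norm ip (fun y => fh (fun i => Zs i w) y - g y) <= 2 * (r + (r + r)) / lam.
  apply: (@klr_stability lam (r + (r + r)) m (fun i => Zs i w)) => //.
    by lra.
  move=> h Hh; have h1 := hE _ nEw _ Hh.
  have tK : tau * K <= 2^-1 by rewrite -ler_pdivlMr.
  have := reg_risk_diff_near_min lam0 tau_gt0 tK Hg Hh gmin.
  rewrite /reg_risk_diff -/L => h2.
  have h3 : tau * L * nrm h <= r * nrm h.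
    by rewrite ler_wpM2r ?rkhs_norm_ge0// -ler_pdivlMr.
  rewrite [leRHS]mulrDl.
  have h4 := le_trans h2 h3.
  move: h1 h4; set s1 := m%:R^-1 * _; set s2 := \int[P]_z _; lra.
have Hd : H (fun y => fh (fun i => Zs i w) y - g y).
  by apply: (rkhsB rkhsH) => //; case: (hfh (fun i => Zs i w)).
apply: le_trans (rkhs_sup_le x Hd) _.
apply: le_trans (ler_wpM2l (ltW K0) st) _.
rewrite (_ : K * _ = 3 / 4 * delta); last by rewrite /r; field; rewrite !gt_eqF.
lra.
Qed.

End concentration.

End klr.

(** * Thresholds and the margin condition *)

Lemma powR_small (R : realType) (b kappa e s0 : R) :
  0 < b -> 0 < kappa -> 0 < e -> 0 < s0 ->
  exists s : R, [/\ 0 < s, s <= s0 & b * s `^ kappa <= e].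
Proof.
move=> b0 k0 e0 s00; have eb0 : 0 < e / b by rewrite divr_gt0.
pose s := Num.min s0 ((e / b) `^ kappa^-1).
have sgt0 : 0 < s by rewrite /s lt_min s00 powR_gt0.
exists s; split=> //; first by rewrite /s ge_min lexx.
have h : s `^ kappa <= ((e / b) `^ kappa^-1) `^ kappa.
  apply: ge0_ler_powR; rewrite ?nnegrE ?powR_ge0 ?(ltW k0) ?(ltW sgt0)//.
  by rewrite /s ge_min lexx orbT.
move: h; rewrite -powRrM mulVf ?gt_eqF// powRr1 ?(ltW eb0)// => h.
by rewrite mulrC -ler_pdivlMr.
Qed.

(** Since ln t <= t - 1 at the square root of n + 1, the logarithm of n + 1 is at most twice the
    square root of n. *)
Lemma eps_n_small (R : realType) (e : R) : 0 < e ->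
  exists N : nat, forall n, (N <= n)%N -> eps_n R n <= e.
Proof.
move=> e0; pose a : R := 2 / (e / 4) ^+ 2.
have e40 : 0 < (e / 4) ^+ 2 by rewrite exprn_gt0// divr_gt0.
have a0 : 0 < a by rewrite divr_gt0.
exists (Num.truncn (a ^+ 2)).+1 => n Nn.
have na : a ^+ 2 <= n%:R.
  by apply: le_trans (ltW (truncnS_gt _)) _; rewrite ler_nat.
have n0 : 0 < (n%:R : R) by apply: lt_le_trans na; rewrite exprn_gt0.
pose q := Num.sqrt (n%:R : R).
have q0 : 0 < q by rewrite sqrtr_gt0.
have qE : q ^+ 2 = n%:R by rewrite sqr_sqrtr// ltW.
have qa : a <= q by rewrite -(ger0_norm (ltW a0)) -sqrtr_sqr ler_wsqrtr.
pose t := Num.sqrt (n.+1%:R : R).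
have t0 : 0 < t by rewrite sqrtr_gt0.
have tE : t ^+ 2 = n%:R + 1 by rewrite sqr_sqrtr// natr1.
have tq : t <= q + 1 by nra.
have lnle : ln (n.+1%:R : R) <= 2 * q.
  rewrite -natr1 -tE expr2 lnM ?posrE//.
  have := @le_ln1Dx R (t - 1); rewrite [1 + _]addrC subrK => h.
  have := h ltac:(lra); lra.
have h : ln (n.+1%:R : R) / n%:R <= (e / 4) ^+ 2.
  rewrite ler_pdivrMr//; apply: le_trans lnle _.
  have -> : (e / 4) ^+ 2 * n%:R = (e / 4) ^+ 2 * q * q by rewrite -qE; ring.
  rewrite ler_pM2r//.
  move: qa; rewrite /a ler_pdivrMr// mulrC; exact.
rewrite /eps_n -ler_pdivlMl//; apply: le_trans (ler_wsqrtr h) _.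
rewrite sqrtr_sqr ger0_norm; first by rewrite mulrC.
by rewrite divr_ge0// ltW.
Qed.

Lemma eps_n_ge0 (R : realType) n : 0 <= eps_n R n.
Proof. by rewrite /eps_n mulr_ge0// sqrtr_ge0. Qed.

Section probability_fine.
Context {R : realType} {dT : measure_display} {T : measurableType dT}.
Variable P : probability T R.
Implicit Types A B : set T.

Lemma prob_fineK A : measurable A -> (fine (P A))%:E = P A.
Proof. by move=> mA; rewrite fineK//; exact: (fin_num_measure P). Qed.

Lemma prob_fine_mono A B : measurable A -> measurable B -> A `<=` B ->
  fine (P A) <= fine (P B).
Proof.
by move=> mA mB AB; rewrite -lee_fin !prob_fineK//; apply: le_measure; rewrite ?inE.
Qed.

Lemma prob_fineU A B : measurable A -> measurable B -> A `&` B = set0 ->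
  fine (P (A `|` B)) = fine (P A) + fine (P B).
Proof.
move=> mA mB AB; apply: EFin_inj; rewrite EFinD !prob_fineK//; last exact: measurableU.
by rewrite measureU.
Qed.

Lemma prob_fineU_le A B : measurable A -> measurable B ->
  fine (P (A `|` B)) <= fine (P A) + fine (P B).
Proof.
move=> mA mB; rewrite -lee_fin EFinD !prob_fineK//; last exact: measurableU.
exact: measureU2.
Qed.

Lemma prob_fineC A : measurable A -> fine (P (~` A)) = 1 - fine (P A).
Proof.
move=> mA; apply: EFin_inj; rewrite EFinB !prob_fineK//; last exact: measurableC.
by rewrite probability_setC.
Qed.

End probability_fine.

Section empirical_measure.
Context {R : realType} {d : nat}.
Variables (n : nat) (Wn : nat -> Rd R d).
Implicit Types A B : set 'rV[R]_d.

Lemma emp_QX_mono A B : A `<=` B -> emp_QX n Wn A <= emp_QX n Wn B.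
Proof.
move=> AB; rewrite /emp_QX ler_wpM2r ?invr_ge0//; apply: ler_sum => j _.
case: asboolP => [/AB Bj|_]; first by rewrite asboolT.
by case: asboolP.
Qed.

Lemma emp_QX_setU A B : emp_QX n Wn (A `|` B) <= emp_QX n Wn A + emp_QX n Wn B.
Proof.
rewrite /emp_QX -mulrDl ler_wpM2r ?invr_ge0// -big_split/=; apply: ler_sum => j _.
case: (asboolP ((A `|` B) _)) => [[Aj|Bj]|_]; first by rewrite (asboolT Aj) lerDl; case: ifP.
  by rewrite (asboolT Bj) lerDr; case: ifP.
by rewrite addr_ge0//; case: ifP.
Qed.

(* With [beta = 0] the threshold is located up to [4 * delta] as soon as
   [etahat] is within [2 * delta] of [eta] off a set of small empirical mass. *)
Lemma Ghat_localization (f eta : 'rV[R]_d -> R) (B : set 'rV[R]_d)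
    (alpha gamma t0 delta : R) : 0 < delta ->
  (forall x, ~ B x -> `|etahat f x - eta x| <= 2 * delta) ->
  emp_QX n Wn [set x | t0 <= eta x] + emp_QX n Wn B <= alpha + gamma + eps_n R n ->
  alpha + gamma + eps_n R n <
    emp_QX n Wn [set x | t0 - 2 * delta <= eta x] - emp_QX n Wn B ->
  Ghat f n Wn alpha 0 gamma `+` [set x | t0 <= eta x] `<=`
    B `|` [set x | t0 - 6 * delta <= eta x <= t0 + 4 * delta].
Proof.
move=> d0 hB hup hlo.
(* The level [t0 + 2 * delta] is feasible: off [B], reaching it forces [eta] to be at least [t0]. *)
have up : (that f n Wn alpha 0 gamma <= (t0 + 2 * delta)%:E)%E.
  apply: ereal_inf_lbound; exists (t0 + 2 * delta) => //=.
  apply: le_trans hup; apply: le_trans (emp_QX_setU _ _); apply: emp_QX_mono => x /=.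
  rewrite addr0 => hx; have [Bx|/hB] := pselect (B x); first by right.
  by rewrite ler_norml => /andP[? ?]; left => /=; lra.
(* A level below [t0 - 4 * delta] is infeasible: off [B], its superlevel set contains the points
   where [eta] is at least [t0 - 2 * delta]. *)
have lo : ((t0 - 4 * delta)%:E <= that f n Wn alpha 0 gamma)%E.
  apply: le_ereal_inf_tmp => _ [t /= ht <-]; rewrite lee_fin leNgt; apply/negP => tt.
  suff : emp_QX n Wn [set x | t0 - 2 * delta <= eta x] <=
      emp_QX n Wn [set x | t + 0 <= etahat f x] + emp_QX n Wn B by lra.
  apply: le_trans (emp_QX_setU _ _); apply: emp_QX_mono => x /= hx.
  have [Bx|/hB] := pselect (B x); first by right.
  by rewrite ler_norml => /andP[? ?]; left => /=; lra.
rewrite setY_def => x [[/= Gx nx]|[/= hx nGx]].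
  have [Bx|/hB] := pselect (B x); first by left.
  move: (le_trans lo Gx); rewrite lee_fin ler_norml => h1 /andP[? ?].
  by right => /=; move/negP: nx; rewrite -ltNge => nx; apply/andP; split; lra.
have [Bx|/hB] := pselect (B x); first by left.
move/negP: nGx; rewrite -ltNge => nGx.
move: (lt_le_trans nGx up); rewrite lte_fin ler_norml => h1 /andP[? ?].
by right => /=; apply/andP; split; lra.
Qed.

End empirical_measure.

Section margin.
Context {R : realType} {d : nat}.
Local Notation Z := (Rd R d * bool)%type.
Variables (Q : probability Z R) (eta : Rd R d -> R).
Hypothesis meta : measurable_fun setT eta.
Variables (t0 alpha delta0 b1 b2 kappa : R).
Hypotheses (del0 : 0 < delta0) (b10 : 0 < b1) (b20 : 0 < b2) (ka0 : 0 < kappa).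
Local Notation q A := (fine (pushforward Q (@fst (Rd R d) bool) A)).
Hypothesis qG : q [set x | t0 <= eta x] = alpha.
Let F (t : R) := pushforward Q (@fst (Rd R d) bool) [set x | eta x <= t].
Hypothesis marg : forall delta : R, `|delta| <= delta0 ->
  ((b1 * `|delta| `^ kappa)%:E <= `|F (t0 + delta)%R - F t0| <=
   (b2 * `|delta| `^ kappa)%:E)%E.

Lemma measurable_fst_preimage (A : set (Rd R d)) : measurable A ->
  measurable ((@fst (Rd R d) bool) @^-1` A).
Proof. by move=> mA; rewrite -[X in measurable X]setTI; exact: measurable_fst. Qed.

Lemma measurable_le_set (t : R) : measurable [set x | eta x <= t].
Proof.
rewrite (_ : [set x | eta x <= t] = [set x | - t <= - eta x]).
  by apply: measurable_ge; exact: measurable_funN.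
by apply/seteqP; split => x /=; rewrite lerN2.
Qed.

Let mge (t : R) : measurable [set x | t <= eta x].
Proof. exact: measurable_ge. Qed.

Lemma marginal_mono (A B : set (Rd R d)) : measurable A -> measurable B ->
  A `<=` B -> q A <= q B.
Proof.
move=> mA mB AB; apply: prob_fine_mono; [exact: measurable_fst_preimage..|].
by move=> z /AB.
Qed.

Lemma marginal_setU (A B : set (Rd R d)) : measurable A -> measurable B ->
  A `&` B = set0 -> q (A `|` B) = q A + q B.
Proof.
move=> mA mB AB; rewrite /pushforward preimage_setU prob_fineU//; try exact: measurable_fst_preimage.
by rewrite -preimage_setI AB preimage_set0.
Qed.

Lemma marginal_setU_le (A B : set (Rd R d)) : measurable A -> measurable B ->
  q (A `|` B) <= q A + q B.
Proof. by move=> mA mB; apply: prob_fineU_le; exact: measurable_fst_preimage. Qed.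

Lemma marginal_setC (A : set (Rd R d)) : measurable A -> q (~` A) = 1 - q A.
Proof. by move=> mA; apply: prob_fineC; exact: measurable_fst_preimage. Qed.

Let G (t : R) : R := q [set x | eta x <= t].

Lemma margin_fine (delta : R) : `|delta| <= delta0 ->
  b1 * `|delta| `^ kappa <= `|G (t0 + delta) - G t0| <= b2 * `|delta| `^ kappa.
Proof.
move=> hd; have FE t : F t = (G t)%:E.
  by rewrite /F /G /pushforward prob_fineK//; apply: measurable_fst_preimage; exact: measurable_le_set.
by have := marg hd; rewrite !FE -EFinB abse_EFin !lee_fin.
Qed.

Let G_mono (s t : R) : s <= t -> G s <= G t.
Proof.
move=> st; apply: marginal_mono; [exact: measurable_le_set..|].
by move=> x /= /le_trans; apply.
Qed.

(** The upper bound in (B) excludes an atom of [eta] at [t0]: such an atom is disjoint from the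
    sublevel set at [t0 - s], so its mass is at most b2 s^kappa for all small [s]. *)
Lemma distribution_at_threshold : G t0 <= 1 - alpha.
Proof.
have mlt : measurable [set x | eta x < t0].
  rewrite (_ : [set x | eta x < t0] = ~` [set x | t0 <= eta x]); first exact: measurableC.
  by apply/seteqP; split => x /=; rewrite ltNge => /negP.
have qlt : q [set x | eta x < t0] = 1 - alpha.
  rewrite -qG -marginal_setC//; congr (fine (pushforward Q fst _)).
  by apply/seteqP; split => x /=; rewrite ltNge => /negP.
apply/ler_addgt0Pr => e e0.
have [s [s0 sd se]] := powR_small b20 ka0 e0 del0.
have meq : measurable ([set x | eta x <= t0] `\` [set x | eta x < t0]).
  by apply: measurableD => //; exact: measurable_le_set.
have h1 : G t0 <= q [set x | eta x < t0] +
    q ([set x | eta x <= t0] `\` [set x | eta x < t0]).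
  apply: le_trans (marginal_setU_le mlt meq).
  apply: marginal_mono; [exact: measurable_le_set|exact: measurableU|].
  by move=> x /= h; have [|] := pselect (eta x < t0); [left|right].
have h2 : q ([set x | eta x <= t0] `\` [set x | eta x < t0]) + G (t0 - s) <= G t0.
  rewrite -marginal_setU//; [|exact: measurable_le_set|]; last first.
    rewrite -subset0 => x [[/= _ /negP]]; rewrite -leNgt => h h'.
    by have := le_trans h h'; lra.
  apply: marginal_mono; [by apply: measurableU => //; exact: measurable_le_set|exact: measurable_le_set|].
  by move=> x [[]//|/=]; lra.
have sn : `|- s| = s by rewrite normrN gtr0_norm.
have := @margin_fine (- s); rewrite sn => /(_ sd) /andP[_].
rewrite ler_norml => /andP[h3 _]; lra.
Qed.

(** The lower bound in (B), taken to the left of [t0]: lowering the level by [s] adds a definite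
    mass, which bars the estimated threshold from falling too low. *)
Lemma margin_lower (s : R) : 0 < s -> s <= delta0 ->
  alpha + b1 * s `^ kappa <= q [set x | t0 - s <= eta x].
Proof.
move=> s0 sd.
have sn : `|- s| = s by rewrite normrN gtr0_norm.
have := @margin_fine (- s); rewrite sn => /(_ sd) /andP[h1 _].
have h2 : G (t0 - s) <= G t0 by apply: G_mono; lra.
move: h1; rewrite ler0_norm ?subr_le0// => h1.
have h3 := distribution_at_threshold.
have h4 : 1 - G (t0 - s) <= q [set x | t0 - s <= eta x].
  rewrite -marginal_setC; last exact: measurable_le_set.
  apply: marginal_mono => //; first by apply: measurableC; exact: measurable_le_set.
  by move=> x /= /negP; rewrite -ltNge => /ltW.
lra.
Qed.

(** The upper bound in (B) on both sides of [t0]. The inequality [a < s] is strict because the band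
    must avoid the closed sublevel set at [t0 - s]. *)
Lemma margin_band (a b s : R) : 0 < s -> s <= delta0 -> a < s -> b <= s -> 0 <= b ->
  measurable [set x | t0 - a <= eta x <= t0 + b] /\
  q [set x | t0 - a <= eta x <= t0 + b] <= 2 * (b2 * s `^ kappa).
Proof.
move=> s0 sd as_ bs b0.
have mb : measurable [set x | t0 - a <= eta x <= t0 + b].
  rewrite (_ : [set x | _] = [set x | t0 - a <= eta x] `&` [set x | eta x <= t0 + b]).
    by apply: measurableI => //; exact: measurable_le_set.
  by apply/seteqP; split => x /= => [/andP//|[-> ->]].
split=> //.
have h : q [set x | t0 - a <= eta x <= t0 + b] + G (t0 - s) <= G (t0 + s).
  rewrite -marginal_setU//; [|exact: measurable_le_set|]; last first.
    rewrite -subset0 => x [/= /andP[h _] h']; lra.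
  apply: marginal_mono; [by apply: measurableU => //; exact: measurable_le_set|exact: measurable_le_set|].
  by move=> x [/= /andP[_ h]|/= h]; lra.
have sn : `|- s| = s by rewrite normrN gtr0_norm.
have := @margin_fine (- s); rewrite sn => /(_ sd) /andP[_].
rewrite ler_norml => /andP[h3 _].
have sn' : `|s| = s by rewrite gtr0_norm.
have := @margin_fine s; rewrite sn' => /(_ sd) /andP[_].
rewrite ler_norml => /andP[_ h4]; lra.
Qed.

End margin.

Lemma emp_QX_tail (R : realType) (d : nat) (dO : measure_display)
    (Omega : measurableType dO) (Pr : probability Omega R) (W : nat -> Omega -> Rd R d)
    (nu : set (Rd R d) -> \bar R) (n : nat) (c : R) (A : set (Rd R d)) :
  pairwise_iid Pr W nu -> (0 < n)%N -> 0 < c -> measurable A ->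
  exists E : set Omega, [/\ measurable E, fine (Pr E) <= 1 / (n%:R * c ^+ 2) &
    forall w, ~ E w -> `|emp_QX n (fun j => W j w) A - fine (nu A)| <= c].
Proof.
move=> iid n0 c0 mA; have c20 : 0 < c ^+ 2 by rewrite exprn_gt0.
have [mE PE] := freq_dev_tail iid n0 c20 mA.
eexists; split; [exact: mE|exact: PE|].
have nr0 : 0 < (n%:R : R) by rewrite ltr0n.
move=> w /negP; rewrite -ltNge.
rewrite (_ : freq_dev W nu n A w = emp_QX n (fun j => W j w) A - fine (nu A)).
  by move=> h; rewrite -(ler_pXn2r (ltn0Sn 1)) ?nnegrE ?normr_ge0 ?(ltW c0)// real_normK ?num_real// ltW.
rewrite /freq_dev /emp_QX sumrB sumr_const card_ord -[fine _ *+ n]mulr_natl mulrBr mulKf ?gt_eqF//.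
congr (_ - _); rewrite mulrC; congr (_ / _); apply: eq_bigr => j _.
rewrite indicE; case: asboolP => h; first by rewrite mem_set.
by rewrite memNset.
Qed.

(** * From near-optimal risk to closeness to the regression function *)

Section near_optimality.
Context {R : realType} {d : nat}.
Local Notation V := 'rV[R]_d.
Local Notation Z := (Rd R d * bool)%type.
Variables (X : set V) (k : V -> V -> R) (H : set (V -> R)).
Variable ip : (V -> R) -> (V -> R) -> R.
Hypotheses (uk : universal_kernel X k H ip) (cX : compact X).
Variables (P : probability Z R) (eta : Rd R d -> R).
Hypotheses (meta : measurable_fun setT eta) (eta01 : forall x, 0 <= eta x <= 1).
Hypothesis etaP : forall A : set (Rd R d), measurable A ->
  P (A `*` [set true]) = (\int[P]_(z in A `*` setT) (eta z.1)%:E)%E.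
Hypothesis PX1 : P (X `*` setT) = 1%E.

(** Universality approximates the continuous near-optimal function on [X] only; off [X] the two
    losses differ by a bounded amount, on a set of probability 0. *)
Lemma rkhs_near_optimal (e : R) : 0 < e ->
  exists2 u, H u & logistic_risk P u <= bayes_entropy P eta + e.
Proof.
move=> e0; case: uk => kpd rk dense.
have [v [cv bv hv]] := continuous_near_optimal meta eta01 etaP (e := e / 2) ltac:(lra).
have [u [Hu uv]] := dense v (continuous_subspaceT cv) (e / 2) ltac:(lra).
exists u => //.
have bu := rkhs_bounded_mfun kpd rk cX Hu.
have [_ [M1 hM1]] := bu; have [_ [M2 hM2]] := bv.
have mX : measurable (X `*` setT : set Z) by apply: measurableX => //; exact: compact_Rd_measurable.
have mXC : measurable (~` (X `*` setT) : set Z) by exact: measurableC.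
have bl (f : Rd R d -> R) : bounded_mfun f ->
    bounded_mfun (fun z : Z => logistic_loss z.2 (f z.1)).
  move=> bf; apply: (@bounded_mfun_label _ _ (fun y (x : Rd R d) => logistic_loss y (f x))) => y.
  exact: bounded_mfun_loss.
have b1 : bounded_mfun (fun z : Z => (M1 + M2) * \1_(~` (X `*` setT)) z).
  by apply: bounded_mfunZ; exact: bounded_mfun_indic.
have b2 : bounded_mfun (fun z : Z => e / 2 + (M1 + M2) * \1_(~` (X `*` setT)) z).
  by apply: bounded_mfunD => //; exact: bounded_mfun_cst.
apply: le_trans (_ : logistic_risk P v + e / 2 <= _); last first.
  by rewrite [in leRHS](splitr e) addrA lerD2r.
have -> : e / 2 = \int[P]_z (e / 2 + (M1 + M2) * \1_(~` (X `*` setT)) z).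
  rewrite expectD//; last exact: bounded_mfun_cst.
  rewrite expect_cst expectZ; last exact: bounded_mfun_indic.
  by rewrite expect_indic// prob_fineC// PX1/= subrr mulr0 addr0.
rewrite -expectD//; last exact: bl.
apply: expect_le; [exact: bl|by apply: bounded_mfunD => //; exact: bl|].
move=> z; have := logistic_loss_lip z.2 (u z.1) (v z.1).
rewrite ler_norml => /andP[_ h].
have [Xz|nXz] := pselect (X z.1).
  rewrite indicE memNset ?mulr0 ?addr0; last by apply; split.
  by have := uv _ Xz; lra.
rewrite indicE mem_set ?mulr1; last by move=> -[].
have := hM1 z.1; have := hM2 z.1; have := ler_normB (u z.1) (v z.1).
move: h; set a := `|_ - _|; lra.
Qed.

Lemma sigmoid_close (g : V -> R) (delta r : R) : H g -> 0 < delta ->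
  logistic_risk P g <= bayes_entropy P eta + r ->
  let B := [set x : Rd R d | delta <= `|sigmoid (g x) - eta x|] in
  measurable B /\ fine (pushforward P fst B) <= 4 * r / delta ^+ 2.
Proof.
move=> Hg delta0 hr B; case: uk => kpd rk _.
have bg := rkhs_bounded_mfun kpd rk cX Hg; have [mg _] := bg.
have mB : measurable B.
  apply: (@measurable_ge _ _ (Rd R d)); apply: measurableT_comp => //.
  by apply: measurable_funB => //; exact: measurable_sigmoid.
split=> //; have d20 : 0 < delta ^+ 2 by rewrite exprn_gt0.
have := markov_bounded P (bounded_mfun_sqdiff meta eta01 mg) (fun=> sqr_ge0 _) d20.
have := risk_excess_lower meta eta01 etaP bg.
set I := \int[P]_z _ => h1 h2.
apply: le_trans (_ : I / delta ^+ 2 <= _); last by rewrite ler_pM2r ?invr_gt0//; lra.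
apply: le_trans h2; rewrite le_eqVlt; apply/orP; left; apply/eqP.
rewrite /pushforward; congr (fine (P _)); apply/seteqP.
by split => z; rewrite /B/= -[(sigmoid _ - _) ^+ 2]real_normK ?num_real//
  ler_pXn2r ?nnegrE ?(ltW delta0).
Qed.

End near_optimality.

(** * Choice of the constants and assembly of the good event *)

Theorem theorem3 (R : realType) (d : nat) (X : set 'rV[R]_d) (alpha : R)
    (P Q : probability (Rd R d * bool)%type R) (eta : Rd R d -> R)
    (dO : measure_display) (Omega : measurableType dO) (Pr : probability Omega R)
    (Z : nat -> Omega -> (Rd R d * bool)%type) (W : nat -> Omega -> Rd R d)
    (k : 'rV[R]_d -> 'rV[R]_d -> R) (H : set ('rV[R]_d -> R))
    (ip : ('rV[R]_d -> R) -> ('rV[R]_d -> R) -> R)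
    (lam : nat -> R) (fhat : nat -> (nat -> (Rd R d * bool)%type) -> 'rV[R]_d -> R)
    (t0 delta0 b1 b2 kappa c0 : R) :
  let PX := pushforward P fst in
  let QX := pushforward Q fst in
  let F := fun t : R => QX [set x | eta x <= t] in
  let G := [set x : Rd R d | t0 <= eta x] in
  (* setting *)
  compact X -> 0 < alpha < 1 ->
  P (X `*` setT) = 1%E -> Q (X `*` setT) = 1%E ->
  (* eta is (a version of) the regression function eta_P(x) = P(Y = 1 | X = x) *)
  measurable_fun setT eta -> (forall x, 0 <= eta x <= 1) ->
  (forall A : set (Rd R d), measurable A ->
     P (A `*` [set true]) = (\int[P]_(z in A `*` setT) (eta z.1)%:E)%E) ->
  (* the samples *)
  two_iid_samples Pr Z W P QX ->
  (* (A) *)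
  0 < t0 <= 1 -> QX G = alpha%:E ->
  (* (B) *)
  0 < delta0 -> 0 < b1 -> 0 < b2 -> 0 < kappa ->
  (forall delta : R, `|delta| <= delta0 ->
     ((b1 * `|delta| `^ kappa)%:E <= `|F (t0 + delta)%R - F t0| <= (b2 * `|delta| `^ kappa)%:E)%E) ->
  (* (C') *)
  0 < c0 -> (forall A : set (Rd R d), measurable A -> (QX A <= c0%:E * PX A)%E) ->
  (* universal kernel and its RKHS *)
  universal_kernel X k H ip ->
  (* regularization parameter *)
  (forall m, 0 < lam m) -> lam @ \oo --> 0 ->
  (fun m => m%:R * lam m ^+ 2) @ \oo --> +oo ->
  (* fhat m D solves the regularized kernel logistic regression problem *)
  (forall m D, klr_solution H ip (lam m) m D (fhat m D)) ->
  forall eps : R, 0 < eps -> exists beta gamma : R,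
    forall e : R, 0 < e -> exists N : nat, forall m n : nat, (N <= m)%N -> (N <= n)%N ->
      exists E : set Omega, [/\ measurable E,
        E `<=` [set w | (QX (Ghat (fhat m (fun i => Z i w)) n (fun j => W j w)
                                   alpha beta gamma `+` G) <= eps%:E)%E] &
        ((1 - e)%:E <= Pr E)%E].
Proof.
move=> PX QX F G cX alpha01 PX1 QX1 meta eta01 etaP iid t01 QG del0 b10 b20 ka0 marg.
move=> c00 QPX uk lam0 lamlim mlamlim hfhat eps eps0.
case: (uk) => kpd rk _.
have [K K1 hK] := kernel_bound kpd rk cX.
have K0 : 0 < K by exact: lt_le_trans ltr01 K1.
have iidZ := two_iid_samplesZ iid; have iidW := two_iid_samplesW iid.
have eps40 : 0 < eps / 4 by rewrite divr_gt0.
have [s [s0 sd hs]] := powR_small b20 ka0 eps40 del0.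
(* The localization band extends [6 * delta] below [t0], and [margin_band] wants [s] strictly
   larger. *)
have [delta dgt0 sE] : exists2 delta : R, 0 < delta & s = 7 * delta.
  by exists (s / 7); [rewrite divr_gt0|field].
have [d2 d2gt0 d4 d6 d4s] : [/\ 2 * delta <= delta0, 0 < 2 * delta, 0 <= 4 * delta,
    6 * delta < s & 4 * delta <= s] by clear -dgt0 sE sd; split; lra.
pose q := b1 * (2 * delta) `^ kappa.
have q0 : 0 < q by rewrite mulr_gt0// powR_gt0// mulr_gt0.
(* With the [dB] and [c] below, feasibility at the upper level costs at most [dB + 2 * c <= q / 4],
   that is [gamma]. At the lower level the extra mass [q] exceeds the sum of [gamma],
   [eps_n <= q / 4] and the same errors. *)
exists 0, (q / 4) => e e0.
have qG : fine (QX G) = alpha by rewrite QG.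
have mG : measurable G by exact: measurable_ge.
have mlo : measurable [set x | t0 - 2 * delta <= eta x] by exact: measurable_ge.
have qlo := margin_lower meta del0 b20 ka0 qG marg (s := 2 * delta) d2gt0 d2.
have [mband qband] := margin_band meta marg (a := 6 * delta) (b := 4 * delta) s0 sd d6 d4s d4.
(* The bound [q / 8] serves the threshold; [eps / 2] is the share of [B] in the final error, the
   band taking the other half. *)
pose dB := Num.min (q / 8) (eps / 2).
have dB0 : 0 < dB by rewrite /dB lt_min !divr_gt0.
have [dB1 dB2] : dB <= q / 8 /\ dB <= eps / 2 by rewrite /dB !ge_min !lexx orbT.
(* Markov's inequality turns an excess risk [3 * e1] into [PX]-mass [12 * e1 / delta ^+ 2], and [c0]
   times that is [dB]. *)
pose e1 := delta ^+ 2 * dB / (12 * c0).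
have e10 : 0 < e1 by rewrite !(divr_gt0, mulr_gt0, exprn_gt0).
have [u Hu hu] := rkhs_near_optimal uk cX meta eta01 etaP PX1 e10.
pose c := q / 16; have cgt0 : 0 < c by rewrite divr_gt0.
have uu0 := ip_ge0 rk Hu.
have [N1 hN1] : exists N, forall m, (N <= m)%N -> lam m / 2 * ip u u <= e1.
  have : \forall m \near \oo, lam m <= 2 * e1 / (1 + ip u u).
    move/cvgrPdist_le : lamlim => /(_ (2 * e1 / (1 + ip u u))).
    have cut0 : 0 < 2 * e1 / (1 + ip u u).
      by apply: divr_gt0; [exact: mulr_gt0|exact: ltr_wpDr].
    move=> /(_ cut0); apply: filterS => m; rewrite sub0r normrN.
    by apply: le_trans; exact: ler_norm.
  move=> [N _ hN]; exists N => m /hN /=.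
  rewrite ler_pdivlMr; last exact: ltr_wpDr.
  by move=> h; have := ltW (lam0 m); clear -h uu0; nra.
(* Gives the bad event of the regression probability at most [e / 4]; [A4] does the same for each of
   the three empirical frequencies. *)
pose A2 := 256 * K ^+ 4 / (delta ^+ 2 * e).
have [N2 hN2] : exists N, forall m, (N <= m)%N -> A2 <= m%:R * lam m ^+ 2.
  by move/cvgryPge : mlamlim => /(_ A2)[N _ hN]; exists N => m /hN.
have q40 : 0 < q / 4 by rewrite divr_gt0.
have [N3 hN3] := eps_n_small q40.
pose A4 := 4 / (c ^+ 2 * e).
have A40 : 0 < A4 by rewrite divr_gt0// mulr_gt0// exprn_gt0.
exists (maxn (maxn N1 N2) (maxn N3 (Num.truncn A4).+1)) => m n.
rewrite !geq_max => /andP[/andP[m1 m2] /andP[_ m4]] /andP[_ /andP[n3 n4]].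
have mgt0 : (0 < m)%N by exact: leq_trans m4.
have ngt0 : (0 < n)%N by exact: leq_trans n4.
have mr0 : 0 < (m%:R : R) by rewrite ltr0n.
have nr0 : 0 < (n%:R : R) by rewrite ltr0n.
have lm0 := lam0 m.
have [g [Hg gmin [E1 [mE1 PE1 hE1]]]] := klr_concentration kpd rk cX K1 hK iidZ lm0 mgt0
  dgt0 e10 (hfhat m).
(* The shares of [e1] are the near-minimality of [g], the penalty of [u] and the excess risk of
   [u]. *)
have hg : logistic_risk P g <= bayes_entropy P eta + 3 * e1.
  have aux (a b c1 d1 h z : R) : a + b <= c1 + d1 + z -> 0 <= a -> c1 <= z ->
    d1 <= h + z -> b <= h + 3 * z by clear; lra.
  apply: aux (gmin u Hu) _ (hN1 m m1) hu.
  by rewrite mulr_ge0 ?divr_ge0 ?(ltW lm0)//; exact: (ip_ge0 rk).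
have [mS PS] := sigmoid_close uk cX meta eta01 etaP Hg dgt0 hg.
set S := [set x | _] in mS PS.
have mX : measurable (X : set (Rd R d)) := compact_Rd_measurable cX.
have QS : fine (QX S) <= dB.
  have := QPX S mS; rewrite /QX /PX /pushforward.
  rewrite -[Q _]prob_fineK; last exact: measurable_fst_preimage.
  rewrite -[P _]prob_fineK; last exact: measurable_fst_preimage.
  rewrite -EFinM lee_fin => /le_trans; apply.
  apply: le_trans (ler_wpM2l (ltW c00) PS) _.
  rewrite le_eqVlt; apply/orP; left; apply/eqP.
  by rewrite /e1; field; rewrite !gt_eqF.
pose B : set (Rd R d) := S `|` ~` X.
have mXC : measurable (~` X : set (Rd R d)) by exact: measurableC.
have mB : measurable B by exact: measurableU.
have QXC : fine (QX (~` X)) = 0.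
  rewrite /QX marginal_setC// /pushforward.
  rewrite (_ : fst @^-1` X = X `*` setT) ?QX1 ?subrr//.
  by apply/seteqP; split => -[x y] //= [].
have QB : fine (QX B) <= dB by apply: le_trans (marginal_setU_le Q mS mXC) _; rewrite -/QX QXC addr0.
have hc (w : Omega) : ~ E1 w -> forall x, ~ B x ->
    `|etahat (fhat m (fun i => Z i w)) x - eta x| <= 2 * delta.
  move=> nE x nB; have h1 := hE1 _ nE x.
  have h2 := le_trans (sigmoid_lip _ _) h1.
  have : `|sigmoid (g x) - eta x| < delta.
    by rewrite ltNge; apply/negP => h; apply: nB; left.
  move: h2; rewrite /etahat -/(sigmoid (fhat m (fun i => Z i w) x)) !ler_norml !ltr_norml.
  set a := sigmoid (fhat _ _ _); set b := sigmoid (g x); clearbody a b; clear -a b.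
  by move=> /andP[? ?] /andP[? ?]; apply/andP; split; lra.
have [E2 [mE2 PE2 hE2]] := emp_QX_tail iidW ngt0 cgt0 mG.
have [E3 [mE3 PE3 hE3]] := emp_QX_tail iidW ngt0 cgt0 mlo.
have [E4 [mE4 PE4 hE4]] := emp_QX_tail iidW ngt0 cgt0 mB.
have p1 : fine (Pr E1) <= e / 4.
  apply: le_trans PE1 _; have h := hN2 m m2.
  have ml0 : 0 < m%:R * lam m ^+ 2 by rewrite mulr_gt0// exprn_gt0.
  have dd : 0 < delta ^+ 2 by rewrite exprn_gt0.
  rewrite ler_pdivrMr; last by rewrite mulr_gt0.
  move: h; rewrite /A2 ler_pdivrMr; last by rewrite mulr_gt0.
  have -> : e / 4 * (m%:R * lam m ^+ 2 * delta ^+ 2) =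
    m%:R * lam m ^+ 2 * (delta ^+ 2 * e) / 4 by field.
  by move=> h; rewrite ler_pdivlMr//; apply: le_trans h; rewrite le_eqVlt; apply/orP; left; apply/eqP; ring.
have pn : 1 / (n%:R * c ^+ 2) <= e / 4.
  have cc : 0 < c ^+ 2 by rewrite exprn_gt0.
  have : A4 <= n%:R by apply: le_trans (ltW (truncnS_gt _)) _; rewrite ler_nat.
  rewrite ler_pdivrMr; last by rewrite mulr_gt0.
  rewrite /A4 ler_pdivrMr; last by rewrite mulr_gt0.
  set p := c ^+ 2; set r := n%:R; clearbody p r; clear; lra.
exists (~` (E1 `|` E2 `|` (E3 `|` E4))).
have mU12 : measurable (E1 `|` E2) by exact: measurableU.
have mU34 : measurable (E3 `|` E4) by exact: measurableU.
have mU : measurable (E1 `|` E2 `|` (E3 `|` E4)) by exact: measurableU.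
split; first exact: measurableC.
- move=> w /= nU.
  have nE1 : ~ E1 w by move=> h; apply: nU; left; left.
  have nE2 : ~ E2 w by move=> h; apply: nU; left; right.
  have nE3 : ~ E3 w by move=> h; apply: nU; right; left.
  have nE4 : ~ E4 w by move=> h; apply: nU; right; right.
  have := hE2 _ nE2; have := hE3 _ nE3; have := hE4 _ nE4.
  rewrite -/QX qG !ler_norml => /andP[? f4] /andP[f3 ?] /andP[? f2].
  have epn := hN3 n n3; have epn0 := eps_n_ge0 R n.
  have sub : Ghat (fhat m (fun i => Z i w)) n (fun j => W j w) alpha 0 (q / 4) `+` G `<=`
      B `|` [set x | t0 - 6 * delta <= eta x <= t0 + 4 * delta].
    apply: Ghat_localization => //; first exact: hc.
      by rewrite -/G; move: f2 f4 epn0 dB1 QB q0; rewrite /c; clear; lra.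
    by move: f3 f4 qlo epn dB1 QB q0; rewrite -/q /c; clear; lra.
  have [Hf _] := hfhat m (fun i => Z i w).
  have mGhat : measurable (Ghat (fhat m (fun i => Z i w)) n (fun j => W j w) alpha 0 (q / 4) : set (Rd R d)).
    rewrite /Ghat -[X in measurable X]setTI; apply: emeasurable_fun_c_infty => //.
    by apply/measurable_EFinP; apply: measurable_sigmoid; have [] := rkhs_bounded_mfun kpd rk cX Hf.
  have mY : measurable (Ghat (fhat m (fun i => Z i w)) n (fun j => W j w) alpha 0 (q / 4)
      `+` G : set (Rd R d)).
    by rewrite setY_def; apply: measurableU; exact: measurableD.
  rewrite /= /QX /pushforward -prob_fineK; last exact: measurable_fst_preimage.
  rewrite lee_fin.
  have := marginal_mono Q mY (measurableU _ _ mB mband) sub.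
  have := marginal_setU_le Q mB mband.
  rewrite -/QX; move: QB qband hs dB2; rewrite /QX /pushforward; clear; lra.
- rewrite -prob_fineK; last exact: measurableC.
  rewrite lee_fin prob_fineC//.
  have := prob_fineU_le Pr mU12 mU34; have := prob_fineU_le Pr mE1 mE2.
  have := prob_fineU_le Pr mE3 mE4; move: p1 PE2 PE3 PE4 pn; clear; lra.
Qed.
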